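(* Let $G=(P,B)$ be an irreducible braced triangulation with $|B|=2$. Then $G$ is isomorphic to one of the following five braced triangulations (an isomorphism being a bijection of vertex sets mapping edges of the triangulation onto edges of the triangulation and braces onto braces): (I) vertices $1,\dots,6$; $P$ is the octahedron, whose edges are all pairs except $\{1,4\},\{2,5\},\{3,6\}$; $B=\{14,25\}$. (II) vertices $a,t,c,m,h,k$; $P$ has edges $at,tc,ca,am,mc,ha,hm,hc,th,mk,kh,kc$; $B=\{tm,ka\}$. (III) the same $P$ as in (II), with $B=\{tm,tk\}$. (IV) vertices $s_1,s_2,s_3,s_4,v_1,v_2,v_3$; $P$ has edges $s_1s_3,s_3v_2,v_2s_1,s_4v_1,v_1s_2,s_2v_2,s_4s_1,v_1s_1,s_2s_1,s_2s_3,v_1s_3,s_4s_3,s_4v_3,v_3s_1,v_3s_3$; $B=\{v_1v_2,v_1v_3\}$. (V) vertices $s_1,s_2,s_3,s_4,v_1,v_2,v_3$; $P$ has edges $s_1s_3,s_3v_2,v_2s_1,s_4v_1,v_1s_2,s_2v_2,s_4s_1,v_1s_1,s_2s_1,s_2s_3,v_1s_3,s_4v_3,v_3s_1,v_3s_3,v_1v_3$; $B=\{v_1v_2,s_4s_3\}$.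
   Context: A sphere graph is a simple graph with a fixed embedding in the 2-sphere without edge crossings. A (sphere) triangulation $P$ is a maximal sphere graph with at least 3 vertices (each of the graphs $P$ listed in the claim is planar and maximal planar, hence has an essentially unique such embedding). An edge $e$ of $P$ is contractible in $P$ if it belongs to precisely two 3-cycles of $P$. A braced triangulation $G=(P,B)$ is the simple graph obtained from a triangulation $P$ by adjoining a set $B$ of additional edges (braces) joining pairs of vertices non-adjacent in $P$. An edge $e$ of $P$ is contractible in $G$ if $e$ is contractible in $P$ and $e$ does not belong to any 3-cycle of $G$ containing a brace. $G$ is irreducible if no edge of $P$ is contractible in $G$. *)

(* Defs.v *)
From mathcomp Require Import all_boot all_fingroup.

Set Implicit Arguments.
Unset Strict Implicit.
Unset Printing Implicit Defensive.

Section Graphs.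

Variable T : finType.
Implicit Types (E P B : {set {set T}}) (r : T -> {perm T}).

(* A simple graph on T is given by its set of edges, each a 2-set. *)
Definition simple_graph E : Prop := forall A, A \in E -> #|A| = 2.

Definition adj E : rel T := fun x y => [set x; y] \in E.

(* An embedding in an oriented surface is recorded by its rotation system:
   r x y is the neighbour of x that follows y in the cyclic order of the edges
   around x. The values of r x outside the neighbours of x are irrelevant. *)
Definition rotation_system E r : Prop :=
  forall x y, adj E x y -> porbit (r x) y = [set z | adj E x z].

(* The facial walk of (x, y) continues from y along the edge that follows yx
   around y; the faces are the orbits of darts under this (injective) map. *)
Definition face_step r (d : T * T) : T * T := (d.2, r d.2 d.1).

Definition face_count E r : nat :=
  fcard (face_step r) [pred d : T * T | adj E d.1 d.2].

Definition isolated_count E : nat := #|[set x | [forall y, ~~ adj E x y]]|.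

Definition component_count E : nat := n_comp (adj E) T.

(* Euler's formula. Each component contributes 2 - 2g to V - E + F, where g is
   its genus, so the equality says that every component has genus 0. An
   isolated vertex has no dart, so its single face is counted separately. *)
Definition spherical E r : Prop :=
  #|T| + (face_count E r + isolated_count E) = #|E| + 2 * component_count E.

Definition sphere_graph E r : Prop :=
  [/\ simple_graph E, rotation_system E r & spherical E r].

(* (E', r') is obtained from (E, r) by drawing additional edges: erasing these
   edges from the cyclic order r' x leaves the cyclic order r x. *)
Definition sphere_extension E r E' r' : Prop :=
  E \subset E' /\
  forall x y, adj E x y ->
    exists2 k, r x y = iter k.+1 (r' x) y
             & forall j, j < k -> ~~ adj E x (iter j.+1 (r' x) y).

Definition triangulation P r : Prop :=
  [/\ 3 <= #|T|,
      sphere_graph P r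
    & forall E' r', sphere_graph E' r' -> sphere_extension P r E' r' -> E' = P].

(* In a simple graph a 3-cycle is determined by its three vertices, and its
   edges are all the pairs of these. *)
Definition three_cycles E : {set {set T}} :=
  [set C : {set T} | (#|C| == 3) &&
     [forall x in C, forall y in C, (x != y) ==> adj E x y]].

Definition contractible P (e : {set T}) : bool :=
  #|[set C in three_cycles P | e \subset C]| == 2.

Definition braced_triangulation P r B : Prop :=
  triangulation P r /\ forall b, b \in B -> #|b| = 2 /\ b \notin P.

Definition braced_contractible P B (e : {set T}) : bool :=
  contractible P e &&
  ~~ [exists C in three_cycles (P :|: B),
        (e \subset C) && [exists b in B, b \subset C]].

Definition irreducible P B : Prop :=
  forall e, e \in P -> ~~ braced_contractible P B e.

End Graphs.

Definition braced_iso (T T' : finType) (P B : {set {set T}})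
    (P' B' : {set {set T'}}) : Prop :=
  exists f : T -> T',
    [/\ bijective f, [set f @: e | e : {set T} in P] = P'
      & [set f @: b | b : {set T} in B] = B'].

Definition edge_set n (s : seq (nat * nat)) : {set {set 'I_n.+1}} :=
  [set:: [seq [set inord p.1; inord p.2] | p <- s]].

(* The vertices 1, ..., 6 of the octahedron are numbered 0, ..., 5 below, so
   that the pairs 14, 25, 36 become 03, 14, 25. *)
Definition P_I : {set {set 'I_6}} :=
  [set e : {set 'I_6} | #|e| == 2]
    :\: edge_set 5 [:: (0, 3); (1, 4); (2, 5)].
Definition B_I : {set {set 'I_6}} := edge_set 5 [:: (0, 3); (1, 4)].

Definition P_II : {set {set 'I_6}} :=
  let a := 0 in let t := 1 in let c := 2 in
  let m := 3 in let h := 4 in let k := 5 in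
  edge_set 5 [:: (a, t); (t, c); (c, a); (a, m); (m, c); (h, a);
                 (h, m); (h, c); (t, h); (m, k); (k, h); (k, c)].
Definition B_II : {set {set 'I_6}} :=
  let a := 0 in let t := 1 in let m := 3 in let k := 5 in
  edge_set 5 [:: (t, m); (k, a)].

Definition P_III : {set {set 'I_6}} := P_II.
Definition B_III : {set {set 'I_6}} :=
  let t := 1 in let m := 3 in let k := 5 in
  edge_set 5 [:: (t, m); (t, k)].

Definition P_IV : {set {set 'I_7}} :=
  let s1 := 0 in let s2 := 1 in let s3 := 2 in let s4 := 3 in
  let v1 := 4 in let v2 := 5 in let v3 := 6 in
  edge_set 6 [:: (s1, s3); (s3, v2); (v2, s1); (s4, v1); (v1, s2);
                 (s2, v2); (s4, s1); (v1, s1); (s2, s1); (s2, s3);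
                 (v1, s3); (s4, s3); (s4, v3); (v3, s1); (v3, s3)].
Definition B_IV : {set {set 'I_7}} :=
  let v1 := 4 in let v2 := 5 in let v3 := 6 in
  edge_set 6 [:: (v1, v2); (v1, v3)].

Definition P_V : {set {set 'I_7}} :=
  let s1 := 0 in let s2 := 1 in let s3 := 2 in let s4 := 3 in
  let v1 := 4 in let v2 := 5 in let v3 := 6 in
  edge_set 6 [:: (s1, s3); (s3, v2); (v2, s1); (s4, v1); (v1, s2);
                 (s2, v2); (s4, s1); (v1, s1); (s2, s1); (s2, s3);
                 (v1, s3); (s4, v3); (v3, s1); (v3, s3); (v1, v3)].
Definition B_V : {set {set 'I_7}} :=
  let s3 := 2 in let s4 := 3 in let v1 := 4 in let v2 := 5 in
  edge_set 6 [:: (v1, v2); (s4, s3)].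

(* Main.v *)
(* Maximality and Euler's formula make P a connected graph all of whose faces are
   triangles. Euler's formula also says that the first homology of the map over F_2
   vanishes, so every 3-cycle bounds a set of faces; a 3-cycle that is not a face
   therefore separates P, into exactly two sides, each adjacent to its three vertices.

   An edge of P in no separating triangle is contractible in P, and hence must lie in
   a 3-cycle with a brace. If there is no separating triangle, every edge meets one of
   the at most four ends of braces, while all degrees are at least 4: this forces the
   octahedron (I). Otherwise, both sides of a separating triangle contain an innermost
   side, met by no separating triangle. Both contain an end of a brace, so the edges at
   an innermost side all meet the three remaining ends, and the side is a single vertex
   of degree 3, called a tip below. If a brace joins two tips, the result is (III).
   If not, the braces are vq and v'q' for tips v and v', every separating triangle
   separates v from v', and q is adjacent to the three neighbours of v: v, q and these
   neighbours form a triangular bipyramid, filling one side of a triangle through q.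
   The edges between the two bipyramids would be contractible, so they leave no room
   for further vertices: they share four vertices (II) or three of them (IV, V). *)

Require Import Defs.
From mathcomp Require Import all_boot all_fingroup all_algebra zify.

Set Implicit Arguments.
Unset Strict Implicit.
Unset Printing Implicit Defensive.

(** * Orbits of permutations *)

(** Maximality is a statement about drawings, so using it requires drawing an edge: on rotation
    systems this multiplies the face permutation by two transpositions, and Euler's formula is
    followed through the change in the number of cycles. Once the sides of 3-cycles are understood,
    the embedding enters mainly through two tools. Each side of a separating triangle contains one
    of the two vertices opposite any given edge of it. And a set of neighbours of [x] that is closed
    under passing from a neighbour to the next one across a face is the whole neighbourhood. The
    rest compares components and neighbourhoods; each of the five graphs is recognised from a list
    of its vertices and a check of all pairs. The counts behind the innermost sides are 3 and 4: if
    such a side had two vertices, all of its vertices would have degree at least 4, while only three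
    brace ends are available to meet their edges. *)

Section Orbits.

Variable T : finType.
Implicit Types (s t : {perm T}) (A B : {set T}).

Definition orbits_on s A := [set porbit s x | x in A].

Lemma fconnect_porbit s x y : fconnect s x y = (y \in porbit s x).
Proof.
apply/idP/porbitP => [xy|[i ->]]; last by rewrite permX fconnect_iter.
by exists (findex s x y); rewrite permX iter_findex.
Qed.

Lemma perm_porbit s x : s x \in porbit s x.
Proof. by rewrite -{1}(expg1 s) mem_porbit. Qed.

Lemma porbit_permE s x : porbit s (s x) = porbit s x.
Proof. by rewrite -{2}(expg1 s) porbit_perm. Qed.

Lemma porbit_closed s A x y :
  (forall z, z \in A -> s z \in A) -> x \in A -> y \in porbit s x -> y \in A.
Proof.
move=> sA xA /porbitP[i ->]; elim: i => [|i IH]; first by rewrite expg0 perm1.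
by rewrite expgSr permM sA.
Qed.

Lemma fcard_orbits_on s A :
  (forall z, z \in A -> s z \in A) -> fcard s A = #|orbits_on s A|.
Proof.
move=> sA; have symc := fconnect_sym (@perm_inj _ s).
have -> : orbits_on s A = [set porbit s x | x in [predI froots s & A]].
  apply/setP=> O; apply/imsetP/imsetP => [[x xA ->]|[x /andP[_ xA] ->]]; last by exists x.
  have rx : froot s x \in porbit s x by rewrite -fconnect_porbit connect_root.
  exists (froot s x); first by rewrite !inE (roots_root symc) (porbit_closed sA xA rx).
  by apply/esym/eqP; rewrite eq_porbit_mem.
rewrite card_in_imset // => x y /andP[/eqP rx _] /andP[/eqP ry _] xy.
rewrite -rx -ry; apply/(fingraph.rootP symc).
by rewrite fconnect_porbit -eq_porbit_mem xy.
Qed.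

Lemma eq_porbit_on s t A x :
    (forall z, z \in A -> s z \in A) -> {in A, s =1 t} -> x \in A ->
  porbit s x = porbit t x.
Proof.
move=> sA st xA.
have key i : (s ^+ i)%g x = (t ^+ i)%g x /\ (s ^+ i)%g x \in A.
  elim: i => [|i [IH IHA]]; first by rewrite !expg0 perm1.
  by rewrite !expgSr !permM -IH -st // sA.
by apply/setP=> y; apply/porbitP/porbitP=> -[i ->]; exists i; case: (key i).
Qed.

Lemma eq_orbits_on s t A :
  (forall z, z \in A -> s z \in A) -> {in A, s =1 t} -> orbits_on s A = orbits_on t A.
Proof. by move=> sA st; apply: eq_in_imset => x; apply: eq_porbit_on. Qed.

Lemma porbitsE s : porbits s = orbits_on s setT.
Proof. by apply/setP=> O; apply/imsetP/imsetP=> -[x _ ->]; exists x. Qed.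

Lemma card_orbits_onU s A B :
    (forall z, z \in A -> s z \in A) -> (forall z, z \in B -> s z \in B) ->
    [disjoint A & B] ->
  #|orbits_on s (A :|: B)| = #|orbits_on s A| + #|orbits_on s B|.
Proof.
move=> sA sB dAB; rewrite /orbits_on imsetU cardsU.
rewrite (_ : _ :&: _ = set0) ?cards0 ?subn0 //.
apply/setP=> O; rewrite !inE; apply/negP=> /andP[/imsetP[x xA ->]].
case/imsetP=> y yB /eqP; rewrite eq_porbit_mem => xy.
by move/pred0P: dAB => /(_ x); rewrite /= xA (porbit_closed sB yB xy).
Qed.

Lemma card_orbits_on1 s A x :
  x \in A -> (forall z, z \in A -> z \in porbit s x) -> #|orbits_on s A| = 1.
Proof.
move=> xA Ax; apply/eqP/cards1P; exists (porbit s x); apply/setP=> O.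
rewrite inE; apply/imsetP/eqP=> [[z /Ax zx ->]|->]; last by exists x.
by apply/eqP; rewrite eq_porbit_mem.
Qed.

Lemma perm_closedC s A :
  (forall z, z \in A -> s z \in A) -> forall z, z \in ~: A -> s z \in ~: A.
Proof.
move=> sA z; rewrite !inE; apply: contra => szA.
by apply: (porbit_closed sA szA); rewrite porbit_sym perm_porbit.
Qed.

End Orbits.

(** Walking from [x], the product runs through the whole cycle of [y] and then through that of [x].
    The merged orbit itself, and not only the number of orbits, decides later whether a second
    transposition merges or splits. *)
Lemma porbit_tperm_mul (T : finType) (s : {perm T}) x y :
  y \notin porbit s x -> porbit (tperm x y * s)%g x = porbit s x :|: porbit s y.
Proof.
move=> yx; set t := (tperm x y * s)%g.
have tx : t x = s y by rewrite permM tpermL.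
have ty : t y = s x by rewrite permM tpermR.
have tD z : z != x -> z != y -> t z = s z.
  by move=> zx zy; rewrite permM tpermD // eq_sym.
have sub p q : p \notin porbit s q -> (forall z, z != p -> z != q -> t z = s z) ->
    t p = s q -> porbit s q \subset porbit t p.
  move=> pq tE tp; apply/subsetP=> z.
  rewrite -porbit_permE -(porbit_permE t) tp => /porbitP[i ->].
  have: (s ^+ i)%g (s q) \in porbit s q.
    by rewrite -(porbit_permE s q) mem_porbit.
  elim: i => [|i IH] zq; first by rewrite expg0 perm1 porbit_id.
  have wq : (s ^+ i)%g (s q) \in porbit s q.
    by rewrite -(porbit_permE s q) mem_porbit.
  rewrite expgSr permM; case: (eqVneq ((s ^+ i)%g (s q)) q) => [->|wq'].
    exact: porbit_id.
  rewrite -tE //; last by apply: contraNneq pq => <-.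
  by rewrite porbit_sym porbit_permE porbit_sym IH.
have xy : x \notin porbit s y by rewrite porbit_sym.
have yt : porbit s y \subset porbit t x by apply: sub tx.
have xt : porbit s x \subset porbit t y.
  by apply: sub ty => // z zy zx; apply: tD.
have txy : porbit t x = porbit t y.
  by apply/esym/eqP; rewrite eq_porbit_mem (subsetP yt) ?porbit_id.
apply/eqP; rewrite eqEsubset subUset {2}txy xt yt !andbT.
apply/subsetP=> z zt; apply: porbit_closed zt; last by rewrite inE porbit_id.
move=> w; rewrite !inE; case: (eqVneq w x) => [->|wx].
  by rewrite tx perm_porbit orbT.
case: (eqVneq w y) => [->|wy]; first by rewrite ty perm_porbit.
by rewrite tD // ![s w \in _]porbit_sym !porbit_permE ![_ \in porbit s w]porbit_sym.
Qed.

(** * Drawing an additional edge *)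

Section Darts.

Variables (T : finType) (E : {set {set T}}).
Implicit Types r : T -> {perm T}.

Definition darts : {set T * T} := [set d | adj E d.1 d.2].

Lemma face_step_inj r : injective (face_step r).
Proof. by move=> [x y] [x' y'] [-> /perm_inj ->]. Qed.

Definition face_perm r : {perm T * T} := perm (@face_step_inj r).

Lemma face_permE r x y : face_perm r (x, y) = (y, r y x).
Proof. by rewrite permE. Qed.

Lemma adjC x y : adj E x y = adj E y x.
Proof. by rewrite /adj setUC. Qed.

Lemma mem_darts x y : ((x, y) \in darts) = adj E x y.
Proof. by rewrite inE. Qed.

Lemma rotation_adj r x y : rotation_system E r -> adj E x y -> adj E x (r x y).
Proof.
by move=> rot xy; move: (perm_porbit (r x) y); rewrite rot // inE.
Qed.

Lemma face_perm_darts r : rotation_system E r ->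
  forall d, d \in darts -> face_perm r d \in darts.
Proof.
move=> rot [x y]; rewrite face_permE !mem_darts => xy.
by rewrite rotation_adj // adjC.
Qed.

Lemma face_countE r : rotation_system E r ->
  face_count E r = #|orbits_on (face_perm r) darts|.
Proof.
move=> rot; rewrite -fcard_orbits_on; last exact: face_perm_darts.
rewrite /face_count (@eq_fcard _ _ (face_perm r)) => [|d]; last by rewrite permE.
by apply: eq_n_comp_r => d; rewrite !inE.
Qed.

(* The values of a rotation system off the graph are arbitrary; making them trivial
   there turns every non-adjacent pair of vertices into a face_perm orbit of size 2. *)
Definition reduced r x : {perm T} := restr_perm [set z | adj E x z] (r x).

Lemma reduced_adj r x y : rotation_system E r -> adj E x y -> reduced r x y = r x y.
Proof.
move=> rot xy; rewrite restr_permE ?inE //.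
by apply/subsetP=> z; rewrite !inE /= => xz; rewrite /aperm rotation_adj.
Qed.

Lemma reduced_nadj r x y : ~~ adj E x y -> reduced r x y = y.
Proof. by move=> xy; rewrite (out_perm (restr_perm_on _ _)) ?inE. Qed.

Lemma adj_irr x : simple_graph E -> adj E x x = false.
Proof.
by move=> sE; apply/negP=> /sE; rewrite setUid cards1.
Qed.

Lemma adj_neq x y : simple_graph E -> adj E x y -> x != y.
Proof. by move=> sE; apply: contraTneq => ->; rewrite adj_irr. Qed.

End Darts.

Section AddEdge.

Variables (T : finType) (E : {set {set T}}) (r : T -> {perm T}).
Hypotheses (sE : simple_graph E) (rotE : rotation_system E r).

Variables u v a b : T.
Hypotheses (uv : u != v) (uvE : ~~ adj E u v).

(* The new edge uv is drawn right after ua around u and right after vb around v;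
   at an isolated end the neighbour is replaced by the other end of uv, so that
   the transposition below is trivial. *)
Definition corner x y c := adj E x c \/ c = y /\ forall z, ~~ adj E x z.
Hypotheses (cua : corner u v a) (cvb : corner v u b).

Let E' := [set u; v] |: E.

(** [reduced E r u] fixes [v], so the product sends [a] to [v] and [v] to the old successor of
    [a]. *)
Definition add_edge x : {perm T} :=
  if x == u then (tperm a v * reduced E r u)%g
  else if x == v then (tperm b u * reduced E r v)%g
  else reduced E r x.

Let vuE : ~~ adj E v u. Proof. by rewrite adjC. Qed.
Let vu : v != u. Proof. by rewrite eq_sym. Qed.

Lemma adj_add x y : adj E' x y = ((x, y) == (u, v)) || ((x, y) == (v, u)) || adj E x y.
Proof.
rewrite /adj in_setU1; congr (_ || _); rewrite !xpair_eqE.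
apply/eqP/idP => [xyuv|/orP[/andP[/eqP-> /eqP->]|/andP[/eqP-> /eqP->]]] //.
  have: x \in [set u; v] by rewrite -xyuv !inE eqxx.
  have: y \in [set u; v] by rewrite -xyuv !inE eqxx orbT.
  have: u \in [set x; y] by rewrite xyuv !inE eqxx.
  have: v \in [set x; y] by rewrite xyuv !inE eqxx orbT.
  rewrite !inE !(eq_sym _ x) !(eq_sym _ y).
  by case: (x == u); case: (x == v); case: (y == u); case: (y == v).
by rewrite setUC.
Qed.

Lemma add_simple : simple_graph E'.
Proof. by move=> A /setU1P[->|/sE //]; rewrite cards2 uv. Qed.

Lemma reduced_rot : rotation_system E (reduced E r).
Proof.
move=> x y xy; rewrite -(rotE xy); apply/esym.
apply: (@eq_porbit_on _ _ _ [set z | adj E x z]) => [z|z|]; rewrite ?inE //.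
  exact: rotation_adj.
by move=> xz; rewrite reduced_adj.
Qed.

Lemma porbit_reduced_nadj x y : ~~ adj E x y -> porbit (reduced E r x) y = [set y].
Proof.
move=> xy; apply/setP=> z; rewrite inE; apply/idP/eqP => [|->]; last exact: porbit_id.
move=> yz; apply/set1P; apply: porbit_closed yz; last by rewrite inE.
by move=> w /set1P->; rewrite reduced_nadj // inE.
Qed.

Lemma porbit_insert x y c : x != y -> ~~ adj E x y -> corner x y c ->
  porbit (tperm c y * reduced E r x)%g y = y |: [set z | adj E x z].
Proof.
move=> xNy xy [xc|[-> isox]]; last first.
  rewrite tperm1 mul1g porbit_reduced_nadj //; apply/setP=> z.
  by rewrite !inE (negPf (isox z)) orbF.
rewrite tpermC porbit_tperm_mul porbit_reduced_nadj ?reduced_rot //.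
by rewrite inE; apply: contraNneq xy => <-.
Qed.

Lemma add_rotation : rotation_system E' add_edge.
Proof.
have key x z c : x != z -> ~~ adj E x z -> corner x z c ->
    forall y, (y == z) || adj E x y ->
    porbit (tperm c z * reduced E r x)%g y = [set w | (w == z) || adj E x w].
  move=> xNz xz cxz y yz; have Oz := porbit_insert xNz xz cxz.
  have -> : [set w | (w == z) || adj E x w] = z |: [set w | adj E x w].
    by apply/setP=> w; rewrite !inE.
  by rewrite -Oz; apply/eqP; rewrite eq_porbit_mem Oz !inE.
move=> x y; rewrite adj_add !xpair_eqE /add_edge.
case: (eqVneq x u) => [->|xu] /=; last case: (eqVneq x v) => [->|xv] /=.
- rewrite (negPf uv) /= orbF => yv; rewrite key //.
  by apply/setP=> z; rewrite !inE adj_add !xpair_eqE eqxx (negPf uv) orbF.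
- move=> yv; rewrite key //.
  by apply/setP=> z; rewrite !inE adj_add !xpair_eqE eqxx (negPf vu).
move=> xy; rewrite reduced_rot //.
by apply/setP=> z; rewrite !inE adj_add !xpair_eqE (negPf xu) (negPf xv).
Qed.

Lemma add_extension : sphere_extension E r E' add_edge.
Proof.
split; first exact: subsetUr.
have key x z c y : ~~ adj E x z -> corner x z c -> adj E x y ->
    exists2 k, r x y = iter k.+1 (tperm c z * reduced E r x)%g y
    & forall j, j < k -> ~~ adj E x (iter j.+1 (tperm c z * reduced E r x)%g y).
  move=> xz cxz xy.
  have yz : y != z by apply: contraNneq xz => <-.
  case: (eqVneq y c) => [yc|yc].
    (* Only the way from [c] to its successor is affected: the new neighbour [z] is met first,
       whence two steps instead of one. *)
    subst y; exists 1 => [|[|//] _] /=; last by rewrite permM tpermL reduced_nadj.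
    by rewrite !permM tpermL (reduced_nadj _ xz) tpermR reduced_adj.
  by exists 0 => //=; rewrite permM tpermD ?reduced_adj // eq_sym.
move=> x y xy; rewrite /add_edge.
case: (eqVneq x u) => [xu|_].
  by subst x; apply: key.
case: (eqVneq x v) => [xv|_]; first by subst x; apply: key.
by exists 0 => //=; rewrite reduced_adj.
Qed.

(** * Counting faces by transpositions *)

Let f0 := face_perm (reduced E r).
Let f1 := (tperm (b, v) (u, v) * f0)%g.

(** The rotation around [u] acts on the darts entering [u] only, so inserting one end of the new
    edge amounts to one transposition of such darts. *)
Lemma face_perm_add : face_perm add_edge = (tperm (a, u) (v, u) * f1)%g.
Proof.
have tE (c d x y z : T) : tperm (c, x) (d, x) (z, y) = (if y == x then tperm c d z else z, y).
  case: tpermP => [[-> ->]|[-> ->]|/eqP n1 /eqP n2].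
  - by rewrite eqxx tpermL.
  - by rewrite eqxx tpermR.
  case: (eqVneq y x) n1 n2 => // ->; rewrite !xpair_eqE eqxx !andbT => n1 n2.
  by rewrite tpermD // eq_sym.
apply/permP=> -[y x]; rewrite /f1 !permM tE /f0 /add_edge.
case: (eqVneq x u) => [->|xu].
  by rewrite tE (negPf uv) !face_permE eqxx permM.
rewrite tE !face_permE (negPf xu); case: (eqVneq x v) => [->|//].
by rewrite permM.
Qed.

Lemma face_reduced_uv : f0 (u, v) = (v, u).
Proof. by rewrite face_permE reduced_nadj. Qed.

Lemma face_reduced_vu : f0 (v, u) = (u, v).
Proof. by rewrite face_permE reduced_nadj. Qed.

Lemma porbit_reduced_uv : porbit f0 (u, v) = [set (u, v); (v, u)].
Proof.
apply/setP=> d; rewrite !inE; apply/idP/orP => [|[/eqP->|/eqP->]].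
- move=> dO; have: d \in [set (u, v); (v, u)]; last by rewrite !inE => /orP.
  apply: porbit_closed dO; last by rewrite !inE eqxx.
  by move=> z /set2P[]->; rewrite ?face_reduced_uv ?face_reduced_vu !inE eqxx ?orbT.
- exact: porbit_id.
by rewrite -face_reduced_uv perm_porbit.
Qed.

Lemma mem_porbit_reduced_uv : ((b, v) \in porbit f0 (u, v)) = (b == u).
Proof.
rewrite porbit_reduced_uv !inE !xpair_eqE eqxx andbT (negPf vu) andbF orbF.
by [].
Qed.

Let rest := ~: darts E'.

Lemma darts_add : darts E' = [set (u, v); (v, u)] :|: darts E.
Proof. by apply/setP=> -[x y]; rewrite inE /= adj_add !inE /=. Qed.

Lemma face_reduced_darts z : z \in darts E -> f0 z \in darts E.
Proof. exact: face_perm_darts reduced_rot z. Qed.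

Lemma face_add_darts z : z \in darts E' -> face_perm add_edge z \in darts E'.
Proof. exact: face_perm_darts add_rotation z. Qed.

Lemma face_add_nondart z : z \in rest -> face_perm add_edge z = f0 z.
Proof.
case: z => x y; rewrite inE mem_darts adj_add !negb_or => /andP[/andP[n1 n2] n3].
rewrite !face_permE /add_edge; congr (_, _).
have n x' y' c : ~~ adj E y' x' -> corner y' x' c -> adj E y' x = false ->
    (y', x) != (y', x') -> (tperm c x' * reduced E r y')%g x = reduced E r y' x.
  rewrite xpair_eqE eqxx /= => yx' cc yx xx'; rewrite permM tpermD //.
    case: cc => [yc|[-> _]]; last by rewrite eq_sym.
    by apply: contraFneq yx => <-.
  by rewrite eq_sym.
move: n1 n2 n3; rewrite adjC; case: (eqVneq y u) => [->|yu].
  move=> _ n2 n3; apply: n => //; first exact: negbTE.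
  by move: n2; rewrite !xpair_eqE eqxx andbT.
case: (eqVneq y v) => [-> n1 _ n3|//]; apply: n => //; first exact: negbTE.
by move: n1; rewrite !xpair_eqE eqxx andbT.
Qed.

(** Orbits are counted on all pairs, where the transposition formula applies. The extra 1 is the
    digon formed by the undrawn darts [(u, v)] and [(v, u)]; the orbits on [rest] will cancel
    against those in [card_porbits_add]. *)
Lemma card_porbits_reduced :
  #|porbits f0| = (face_count E r + #|orbits_on f0 rest|).+1.
Proof.
have uvclosed z : z \in [set (u, v); (v, u)] -> f0 z \in [set (u, v); (v, u)].
  by move=> /set2P[]->; rewrite ?face_reduced_uv ?face_reduced_vu !inE eqxx ?orbT.
have cl : forall z, z \in darts E' -> f0 z \in darts E'.
  move=> z; rewrite darts_add => /setUP[/uvclosed|/face_reduced_darts] zz; apply/setUP; by [left|right].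
rewrite porbitsE -(setUCr (darts E')).
rewrite card_orbits_onU //; last first.
- by rewrite /rest -setI_eq0 setICr.
- exact: perm_closedC.
rewrite {1}darts_add card_orbits_onU //; last first.
- rewrite -setI_eq0; apply/eqP/setP=> z; rewrite !inE; apply/negP.
  by move=> /andP[/orP[]/eqP->] /=; apply/negP.
- exact: face_reduced_darts.
rewrite (@card_orbits_on1 _ _ _ (u, v)) ?inE ?eqxx //; last by move=> z; rewrite porbit_reduced_uv.
rewrite (face_countE rotE) (_ : orbits_on f0 (darts E) = orbits_on (face_perm r) (darts E)) //.
apply: eq_orbits_on => [|[x y]]; first exact: face_reduced_darts.
by rewrite mem_darts adjC => xy; rewrite /f0 !face_permE reduced_adj.
Qed.

Lemma card_porbits_add :
  #|porbits (face_perm add_edge)| =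
  face_count E' add_edge + #|orbits_on f0 rest|.
Proof.
rewrite porbitsE -(setUCr (darts E')).
rewrite card_orbits_onU //; last first.
- by rewrite /rest -setI_eq0 setICr.
- exact: perm_closedC face_add_darts.
- exact: face_add_darts.
rewrite (face_countE add_rotation); congr (_ + #|pred_of_set _|).
apply: eq_orbits_on => [|z]; first exact: perm_closedC face_add_darts.
exact: face_add_nondart.
Qed.

Lemma card_add : #|E'| = #|E|.+1.
Proof. by rewrite cardsU1 uvE. Qed.

Lemma card_porbits_half_add : #|porbits f1| + (b != u).*2 = #|porbits f0| + (b != u).
Proof.
have := porbits_mul_tperm f0 (b, v) (u, v); rewrite /= mem_porbit_reduced_uv.
by rewrite xpair_eqE eqxx andbT.
Qed.

Lemma porbit_half_add : b != u -> porbit f1 (v, u) = porbit f0 (b, v) :|: [set (u, v); (v, u)].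
Proof.
move=> bu; rewrite -porbit_reduced_uv -porbit_tperm_mul.
  apply/eqP; rewrite eq_porbit_mem porbit_tperm_mul.
    by rewrite inE porbit_reduced_uv !inE eqxx !orbT.
  by rewrite porbit_sym mem_porbit_reduced_uv.
by rewrite porbit_sym mem_porbit_reduced_uv.
Qed.

(** The first transposition merges the digon into the face of [(b, v)]; the second cuts the result
    in two, as it contains both [(a, u)] and [(v, u)]. The digon was counted before, so the number
    of faces grows by one. *)
Lemma card_porbits_add_same : adj E u a -> adj E v b -> (a, u) \in porbit f0 (b, v) ->
  #|porbits (face_perm add_edge)| = #|porbits f0|.
Proof.
move=> ua vb ab; have bu : b != u by apply: contraNneq vuE => <-.
have av : a != v by apply: contraNneq uvE => <-.
have := porbits_mul_tperm f1 (a, u) (v, u).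
rewrite /= -face_perm_add porbit_half_add // inE ab /= addn0 => ->.
by move: card_porbits_half_add; rewrite bu xpair_eqE eqxx andbT av -addnn addnA => /addIn.
Qed.

Lemma spherical_add_same : spherical E r ->
    adj E u a -> adj E v b -> (a, u) \in porbit (face_perm r) (b, v) ->
  connect (adj E) u v -> spherical E' add_edge.
Proof.
move=> sph ua vb ab uvc.
have f0E : porbit f0 (b, v) = porbit (face_perm r) (b, v).
  apply: (@eq_porbit_on _ _ _ (darts E)) => [|[x y]|]; first exact: face_reduced_darts.
    by rewrite mem_darts adjC => xy; rewrite /f0 !face_permE reduced_adj.
  by rewrite mem_darts adjC.
have := card_porbits_add_same ua vb; rewrite f0E => /(_ ab).
rewrite card_porbits_reduced card_porbits_add -addSn => /addIn F'.
rewrite /spherical F' card_add.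
have -> : isolated_count E' = isolated_count E.
  apply: eq_card => x; rewrite !inE.
  apply/forallP/forallP=> iso y; last first.
    rewrite adj_add !xpair_eqE !negb_or (iso y) andbT.
    have /negPf-> : x != u by apply: contraTneq ua => <-; apply: iso.
    by have /negPf-> : x != v by apply: contraTneq vb => <-; apply: iso.
  by apply: contra (iso y); rewrite adj_add => ->; rewrite orbT.
have -> : component_count E' = component_count E.
  apply/esym/eq_n_comp => x y; apply/idP/idP.
    by apply: connect_sub => {}x {}y xy; rewrite connect1 // adj_add xy orbT.
  apply: connect_sub => {}x {}y; rewrite adj_add => /orP[/orP[]|xy]; last exact: connect1.
    by case/eqP=> -> ->.
  case/eqP=> -> ->; rewrite (sym_connect_sym _) //; exact: adjC.
by rewrite addSn addnS sph addSn.
Qed.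

Lemma connect_face_reduced d d' : d' \in porbit f0 d -> connect (adj E) d.1 d.2 ->
  connect (adj E) d.1 d'.1 /\ connect (adj E) d.1 d'.2.
Proof.
move=> dd' d12; apply/andP.
suff: d' \in [set e | connect (adj E) d.1 e.1 && connect (adj E) d.1 e.2] by rewrite inE.
apply: porbit_closed dd'; last by rewrite inE connect0.
move=> [x y]; rewrite face_permE !inE /= => /andP[dx dy]; rewrite dy /=.
have [yx|yx] := boolP (adj E y x); last by rewrite reduced_nadj.
by apply: connect_trans dy (connect1 _); rewrite reduced_adj // rotation_adj.
Qed.

(** Faces stay within a component, so both transpositions merge: the digon is joined to a face at
    [v] and then to a face at [u]. At an isolated end the transposition is trivial. *)
Lemma card_porbits_add_diff : ~~ connect (adj E) u v ->
  #|porbits (face_perm add_edge)| + (a != v) + (b != u) = #|porbits f0|.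
Proof.
move=> cuv.
have n1 : #|porbits f1| + (b != u) = #|porbits f0|.
  by move: card_porbits_half_add; rewrite -addnn addnA => /addIn.
rewrite -n1; congr (_ + _).
have n2 := porbits_mul_tperm f1 (a, u) (v, u).
move: n2; rewrite /= -face_perm_add xpair_eqE eqxx andbT.
have [->|av] := eqVneq a v; first by rewrite porbit_id /= !addn0.
suff -> : (a, u) \notin porbit f1 (v, u) by rewrite -[true.*2]/(1 + 1) addnA => /addIn.
have auO : (a, u) \notin porbit f0 (v, u).
  rewrite porbit_sym -porbit_permE face_permE -/f0.
  apply/negP=> /connect_face_reduced /=.
  case: cua => [ua|[av' _]]; last by rewrite av' eqxx in av.
  rewrite reduced_adj // (connect1 (rotation_adj _ _)) // => /(_ isT)[].
  by rewrite (negPf cuv).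
have [bu|bu] := eqVneq b u; first by rewrite /f1 bu tperm1 mul1g.
rewrite porbit_half_add // inE negb_or -porbit_reduced_uv; apply/andP; split; last first.
  by rewrite -face_reduced_vu porbit_permE.
case: cvb => [vb|[bu' _]]; last by rewrite bu' eqxx in bu.
apply/negP => /connect_face_reduced /=.
rewrite connect1 1?adjC // => /(_ isT)[_].
rewrite (sym_connect_sym (adjC E)) => ub.
case/negP: cuv; apply: connect_trans ub _; by rewrite connect1 1?adjC.
Qed.

Lemma corner_isolated x y c : ~~ adj E x y -> corner x y c ->
  [forall z, ~~ adj E x z] = (c == y).
Proof.
move=> xy [xc|[-> iso]]; last by rewrite eqxx; apply/forallP.
have /negPf-> : c != y by apply: contraNneq xy => <-.
by apply/negP=> /forallP/(_ c); rewrite xc.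
Qed.

Lemma isolated_add : isolated_count E' + (a == v) + (b == u) = isolated_count E.
Proof.
pose S := [set x | [forall y, ~~ adj E x y]].
have uS : (u \in S) = (a == v) by rewrite inE (corner_isolated uvE cua).
have vS : (v \in S) = (b == u) by rewrite inE (corner_isolated vuE cvb).
rewrite /isolated_count -/S (cardsD1 v S) (cardsD1 u (S :\ v)) in_setD1 uv uS vS.
rewrite addnC [(a == v) + _]addnC; congr (_ + (_ + _)).
apply: eq_card => x; rewrite !inE; apply/forallP/and3P => [iso|[xu xv /forallP iso] y].
  have xu : x != u by apply: contraTneq (iso v) => ->; rewrite adj_add !eqxx.
  have xv : x != v by apply: contraTneq (iso u) => ->; rewrite adj_add eqxx orbT.
  split=> //; apply/forallP=> y; apply: contra (iso y); rewrite adj_add => ->.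
  by rewrite orbT.
by rewrite adj_add !xpair_eqE (negPf xu) (negPf xv); apply: iso.
Qed.

Lemma component_add : ~~ connect (adj E) u v ->
  component_count E = (component_count E').+1.
Proof.
move=> cuv.
have symE : connect_sym (adj E) := sym_connect_sym (adjC E).
have symE' : connect_sym (adj E') := sym_connect_sym (adjC E').
(* [A] is the union of the components of [u] and [v], two for [E] and one for the new graph; off [A]
   the components agree. *)
pose A := closure (adj E) (pred2 u v).
have clA : closed (adj E) A by apply: closure_closed.
have uA : u \in A by apply: mem_closure; rewrite inE eqxx.
have vA : v \in A by apply: mem_closure; rewrite inE eqxx orbT.
have clA' : closed (adj E') A.
  move=> x y; rewrite adj_add => /orP[/orP[]/eqP[-> ->]|]; rewrite ?uA ?vA //.
  exact: clA.
rewrite /component_count (n_compC A (adj E)) (n_compC A (adj E')) addnC [in RHS]addnC -addSn.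
rewrite [X in _ + X](_ : _ = 2); last by rewrite n_comp_closure2 // cuv.
have sub x y : connect (adj E) x y -> connect (adj E') x y.
  apply: connect_sub => {}x {}y xy; apply: connect1; by rewrite adj_add xy orbT.
rewrite [X in _ = _ + X](_ : _ = 1) ?addn1; last first.
  rewrite -(n_comp_connect symE' u); apply: eq_n_comp_r => x.
  apply/idP/idP => [/pred0Pn[y /andP[/sub xy yuv]]|ux].
    suff: connect (adj E') x u by rewrite symE'.
    case/orP: yuv => /eqP yE; first by rewrite -yE.
    by apply: connect_trans xy _; rewrite yE symE' connect1 // adj_add eqxx.
  by rewrite -(closed_connect clA' ux).
rewrite addn2; congr (_.+2).
have cE x y : x \notin A -> connect (adj E') x y = connect (adj E) x y.
  move=> xA; apply/idP/idP; last exact: sub.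
  case/connectP=> p; elim: p x xA => [|z p IH] x xA /=; first by move=> _ ->.
  case/andP=> xz pz yE; apply: (@connect_trans _ _ z); last first.
    by apply: IH; rewrite // -(clA' _ _ xz).
  move: xz; rewrite adj_add => /orP[|xz]; last exact: connect1.
  by case/orP=> /eqP[xE _]; rewrite xE ?uA ?vA in xA.
apply: eq_card => x; rewrite !inE; case xA: (x \in A); rewrite ?andbF ?andbT //.
by rewrite /fingraph.roots /fingraph.root (eq_pick (fun y => cE x y (negbT xA))).
Qed.

(** An end that ceases to be isolated makes up for its trivial transposition. So the sum of
    [face_count] and [isolated_count] drops by one in all cases, as does the right side of Euler's
    formula. *)
Lemma spherical_add_diff : spherical E r ->
  ~~ connect (adj E) u v -> spherical E' add_edge.
Proof.
move=> sph cuv; have := card_porbits_add_diff cuv.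
rewrite card_porbits_reduced card_porbits_add => F.
move: sph; rewrite /spherical card_add (component_add cuv) -isolated_add.
move: F; case: (a == v) (b == u) => [] [] /=; lia.
Qed.

End AddEdge.

(** * A Jordan curve theorem for 3-cycles *)

Section Rotation.

Variables (T : finType) (E : {set {set T}}) (r : T -> {perm T}).
Hypothesis rotE : rotation_system E r.
Hypothesis conE : forall x y, connect (adj E) x y.

Lemma rotation_ind (Q : T -> Prop) x y z : adj E x y -> adj E x z -> Q y ->
  (forall w, adj E x w -> Q w -> Q (r x w)) -> Q z.
Proof.
move=> xy xz Qy Qr; have: z \in porbit (r x) y by rewrite rotE // inE.
case/porbitP=> i ->; suff: adj E x ((r x ^+ i)%g y) /\ Q ((r x ^+ i)%g y) by case.
elim: i => [|i [IH1 IH2]]; first by rewrite expg0 perm1.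
by rewrite expgSr permM; split; [apply: rotation_adj | apply: Qr].
Qed.

(** Reversal followed by a face step is rotation around a vertex. Hence [s] depends only on the
    first vertex of a dart and, reversal carrying the value along edges, not even on it. *)
Lemma dart_constant (A : Type) (s : T -> T -> A) :
    (forall x y, adj E x y -> s x y = s y (r y x)) ->
    (forall x y, adj E x y -> s x y = s y x) ->
  forall x y x' y', adj E x y -> adj E x' y' -> s x y = s x' y'.
Proof.
move=> sf sr; have vs x y z : adj E x y -> adj E x z -> s x y = s x z.
  move=> xy xz; apply: (rotation_ind (Q := fun w => s x y = s x w) xy xz) => // w xw ->.
  by rewrite sr // sf // adjC.
move=> x y x' y' xy xy'; have /connectP[p] := conE x x'.
elim: p x y xy => [|z p IH] x y xy /=; first by move=> _ xE; subst; apply: vs.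
case/andP=> xz zp xE; rewrite (vs _ _ _ xy xz) sr //.
by apply: IH => //; rewrite adjC.
Qed.

End Rotation.

Lemma F2_addxx (x : 'F_2) : (x + x = 0)%R.
Proof. by apply/val_inj; case: x => [[|[|]]]. Qed.

Lemma F2_add_neq0 (x y : 'F_2) : (x + y != 0)%R = (x != 0)%R (+) (y != 0)%R.
Proof. by case: x y => [[|[|//]] ?] [[|[|//]] ?]. Qed.

Section Jordan.

Variables (T : finType) (E : {set {set T}}) (r : T -> {perm T}).
Hypotheses (sE : simple_graph E) (rotE : rotation_system E r).
Hypothesis conE : forall x y, connect (adj E) x y.
Hypothesis (T_gt1 : 1 < #|T|) (sph : spherical E r).

Import GRing.Theory.
Local Open Scope ring_scope.

Let F : {set {set T * T}} := orbits_on (face_perm r) (darts E).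
Let edge (d : T * T) := [set d.1; d.2].

Let fval (i : 'I_#|F|) : {set T * T} := enum_val i.
Let eval (j : 'I_#|E|) : {set T} := enum_val j.

(** [M] and [N] are the boundary maps over F_2 from faces to edges and from edges to vertices. An
    edge with the same face on both sides gets the entry 1 + 1 = 0. *)
Let M : 'M['F_2]_(#|F|, #|E|) :=
  \matrix_(i, j) \sum_(d in darts E | edge d == eval j) (d \in fval i)%:R.
Let N : 'M['F_2]_(#|E|, #|T|) :=
  \matrix_(j, k) (enum_val k \in eval j)%:R.

Lemma exists_adj x : exists y, adj E x y.
Proof.
have /card_gt0P[y] : (0 < #|predC1 x|)%N by rewrite cardC1 -subn1 subn_gt0.
rewrite !inE => yx; have /connectP[[|z p] /=] := conE x y.
  by move=> _ yE; rewrite yE eqxx in yx.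
by case/andP=> xz _ _; exists z.
Qed.

Lemma euler : (#|T| + #|F| = #|E| + 2)%N.
Proof.
move: sph; rewrite /spherical (face_countE rotE) -/F.
have -> : isolated_count E = 0%N.
  apply/eqP; rewrite cards_eq0; apply/eqP/setP=> x; rewrite !inE.
  by apply/negP=> /forallP iso; have [y xy] := exists_adj x; rewrite (negPf (iso y)) in xy.
have -> : component_count E = 1%N; last by rewrite addn0.
have /card_gt0P[x _] : (0 < #|T|)%N by apply: ltnW.
rewrite -(n_comp_connect (sym_connect_sym (adjC E)) x); apply: eq_n_comp_r => y.
exact/esym/conE.
Qed.

Lemma edge_index x y : adj E x y -> exists j, eval j = [set x; y].
Proof.
move=> xy; have xyE : [set x; y] \in E := xy.
by exists (enum_rank_in xyE [set x; y]); rewrite /eval enum_rankK_in.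
Qed.

Lemma fvalP i : exists2 d, d \in darts E & fval i = porbit (face_perm r) d.
Proof. by have /imsetP := enum_valP i. Qed.

Lemma face_val_closed (i : 'I_#|F|) d :
  (face_perm r d \in fval i) = (d \in fval i).
Proof.
have [d0 _ ->] := fvalP i.
by rewrite ![_ \in porbit _ d0]porbit_sym porbit_permE.
Qed.

Lemma face_val_dart (i : 'I_#|F|) d : d \in fval i -> d \in darts E.
Proof.
have [d0 d0E ->] := fvalP i.
apply: porbit_closed d0E; exact: face_perm_darts.
Qed.

Lemma boundary_mulmx : M *m N = 0.
Proof.
apply/matrixP=> i k; rewrite !mxE; set v := enum_val k; set f := fval i.
transitivity (\sum_(d in darts E) (d \in f)%:R * (v \in edge d)%:R : 'F_2).
  rewrite [RHS](partition_big edge (mem E)) => [|d]; last by rewrite inE.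
  rewrite [RHS]big_enum_val /=.
  apply: eq_bigr => j _; rewrite !mxE big_distrl /=.
  by apply: eq_bigr => d /andP[_ /eqP->].
have edgeE d : d \in darts E -> (v \in edge d)%:R = (d.1 == v)%:R + (d.2 == v)%:R :> 'F_2.
  case: d => x y; rewrite mem_darts !inE !(eq_sym v) => /(adj_neq sE) xy.
  case: (eqVneq x v) xy => [->|_ _]; last by rewrite add0r.
  by rewrite eq_sym => /negPf->; rewrite addr0.
transitivity (\sum_(d in f) ((d.1 == v)%:R + (d.2 == v)%:R) : 'F_2).
  rewrite big_mkcond [RHS]big_mkcond; apply: eq_bigr => d _.
  case: ifP => dE; last by case: ifP => // /face_val_dart; rewrite dE.
  by rewrite edgeE //; case: ifP; rewrite ?mul1r ?mul0r.
(* Along a facial walk, the head of a dart is the tail of the next one, so the two sums agree and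
   cancel. *)
rewrite big_split /= [X in X + _](reindex_inj (@perm_inj _ (face_perm r))) /=.
rewrite (eq_bigl (mem f)) => [|d]; last exact: face_val_closed.
rewrite (eq_bigr (fun d => (d.2 == v)%:R)) => [|[x y] _]; last by rewrite face_permE.
exact: F2_addxx.
Qed.

Let face_fun (u : 'rV['F_2]_#|F|) x y : 'F_2 :=
  \sum_i u 0 i * ((x, y) \in fval i)%:R.

Lemma face_fun_step u x y : face_fun u x y = face_fun u y (r y x).
Proof.
by apply: eq_bigr => i _; rewrite -(face_val_closed i (x, y)) face_permE.
Qed.

Lemma face_funE u i x y : (x, y) \in fval i -> face_fun u x y = u 0 i.
Proof.
move=> xyi; rewrite /face_fun (bigD1 i) //= xyi mulr1 big1 ?addr0 // => j ji.
case: (boolP (_ \in _)) => [xyj|]; last by rewrite mulr0.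
case/eqP: ji; apply: enum_val_inj; move: xyi xyj.
rewrite -/(fval i) -/(fval j).
have [d _ ->] := fvalP i; have [d' _ ->] := fvalP j.
rewrite -!eq_porbit_mem => /eqP <- /eqP <-.
by [].
Qed.

Lemma mulmx_face u x y (xy : adj E x y) j :
  eval j = [set x; y] -> (u *m M) 0 j = face_fun u x y + face_fun u y x.
Proof.
move=> jxy; rewrite mxE.
transitivity (\sum_(d in darts E | edge d == [set x; y]) face_fun u d.1 d.2).
  rewrite exchange_big /=; apply: eq_bigr => i _.
  by rewrite mxE jxy big_distrr; apply: eq_bigr => -[].
have xNy := adj_neq sE xy.
rewrite (bigD1 (x, y)) /=; last by rewrite mem_darts xy eqxx.
rewrite (bigD1 (y, x)) /=; last first.
  by rewrite mem_darts adjC xy [edge _]setUC eqxx xpair_eqE eq_sym (negPf xNy).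
rewrite big1 ?addr0 // => -[x' y'] /=; rewrite mem_darts => /andP[/andP[/andP[xy' /eqP e]]].
have: x' \in [set x; y] by rewrite -e !inE eqxx.
have: y' \in [set x; y] by rewrite -e !inE eqxx orbT.
have := adj_neq sE xy'.
by rewrite !inE => /[swap] /orP[]/eqP-> /[swap] /orP[]/eqP->; rewrite eqxx.
Qed.

(** A set of faces without boundary has equal coefficients on both sides of every edge, so
    [dart_constant] makes it empty or everything. *)
Lemma kermx_face : (\rank (kermx M) <= 1)%N.
Proof.
apply: leq_trans (rank_leq_row (const_mx 1 : 'rV['F_2]_#|F|)).
apply/mxrankS/row_subP=> i0; set u := row i0 _.
have uM : u *m M = 0 by rewrite -row_mul mulmx_ker row0.
have uc i i' : u 0 i = u 0 i'.
  have [[x y] xyE ii] := fvalP i.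
  have [[x' y'] xyE' ii'] := fvalP i'.
  rewrite -(@face_funE u i x y) ?ii ?porbit_id //.
  rewrite -(@face_funE u i' x' y') ?ii' ?porbit_id //.
  move: xyE xyE'; rewrite !mem_darts => xyE xyE'.
  apply: (dart_constant (s := face_fun u) rotE conE) xyE xyE' => a b xy.
    exact: face_fun_step.
  have [j jE] := edge_index xy.
  have := mulmx_face u xy jE; rewrite uM mxE => s0.
  apply/eqP; rewrite -subr_eq0; apply/eqP; rewrite [RHS]s0; congr (_ + _).
  by apply/eqP; rewrite eq_sym -addr_eq0 F2_addxx.
case: (posnP #|F|) => [F0|F_gt0].
  apply/submxP; exists 0; apply/rowP=> i; by have := ltn_ord i; rewrite {2}F0.
apply/submxP; exists (u 0 (Ordinal F_gt0))%:M.
by apply/rowP=> i; rewrite mul_scalar_mx [RHS]mxE [const_mx _ _ _]mxE mulr1; apply: uc.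
Qed.

(** A vector killed by [N^T] takes equal values at the two ends of every edge, hence is constant by
    connectedness; this bounds the rank of [N] from below. *)
Lemma kermx_vertex : (\rank (kermx N^T) <= 1)%N.
Proof.
apply: leq_trans (rank_leq_row (const_mx 1 : 'rV['F_2]_#|T|)).
apply/mxrankS/row_subP=> i0; set u := row i0 _.
have uN : u *m N^T = 0 by rewrite -row_mul mulmx_ker row0.
have NE k j : N^T k j = (enum_val k \in eval j)%:R by rewrite !mxE.
pose g x := u 0 (enum_rank x).
have gxy x y : adj E x y -> g x = g y.
  move=> xy; have xNy := adj_neq sE xy.
  have [j jE] := edge_index xy; have : (u *m N^T) 0 j = 0 by rewrite uN mxE.
  rewrite mxE /= (bigD1 (enum_rank x)) // (bigD1 (enum_rank y)) /=; last first.
    by rewrite (inj_eq enum_rank_inj) eq_sym.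
  rewrite !NE !enum_rankK jE !inE !eqxx orbT !mulr1 big1 => [|k].
    rewrite addr0 -/(g x) -/(g y) => gg.
    by apply/eqP; rewrite -subr_eq0 -gg; apply/eqP; congr (_ + _);
       apply/eqP; rewrite eq_sym -addr_eq0 F2_addxx.
  case/andP=> kx ky; rewrite NE jE !inE.
  rewrite -(inj_eq enum_rank_inj) enum_valK (negPf kx).
  by rewrite -(inj_eq enum_rank_inj) enum_valK (negPf ky) mulr0.
have gc x y : g x = g y.
  have /connectP[p] := conE x y; elim: p x => [x _ -> //|z p IH x] /= /andP[xz zp] yE.
  by rewrite (gxy _ _ xz); apply: IH.
have T_gt0 : (0 < #|T|)%N := ltnW T_gt1.
apply/submxP; exists (u 0 (Ordinal T_gt0))%:M.
apply/rowP=> i; rewrite mul_scalar_mx [RHS]mxE [const_mx _ _ _]mxE mulr1.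
by have := gc (enum_val i) (enum_val (Ordinal T_gt0)); rewrite /g !enum_valK.
Qed.

(* The cycle space has dimension |E| - |T| + 1 and the boundaries one of #faces - 1;
   these are equal by Euler's formula. *)
Lemma cycle_boundary (C : 'rV['F_2]_#|E|) : C *m N = 0 -> (C <= M)%MS.
Proof.
move/sub_kermxP=> CN; apply: submx_trans CN _.
have MN : (M <= kermx N)%MS by apply/sub_kermxP/boundary_mulmx.
rewrite -(geq_leqif (mxrank_leqif_sup MN)).
have := kermx_face; have := kermx_vertex; have := euler.
have := rank_leq_row M; have := rank_leq_col N; have := rank_leq_row N.
rewrite !mxrank_ker mxrank_tr; lia.
Qed.

(* The function s is the indicator of a set of faces, given on the darts: over F_2 the
   boundary of this set is the 3-cycle xyz. *)
Lemma jordan_triangle x y z : adj E x y -> adj E y z -> adj E z x ->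
  exists s : T -> T -> bool,
    (forall v w, s v w = s w (r w v)) /\
    (forall v w, adj E v w ->
       s v w (+) s w v = (v \in [set x; y; z]) && (w \in [set x; y; z])).
Proof.
move=> xy yz zx.
pose C : 'rV['F_2]_#|E| := \row_j (eval j \subset [set x; y; z])%:R.
have [xNy yNz zNx] := And3 (adj_neq sE xy) (adj_neq sE yz) (adj_neq sE zx).
have CN : C *m N = 0.
  apply/rowP=> k; rewrite !mxE; set v := enum_val k.
  transitivity (\sum_(e in E) (e \subset [set x; y; z])%:R * (v \in e)%:R : 'F_2).
    rewrite [RHS](big_enum_val (fun e : {set T} => (e \subset [set x; y; z])%:R * (v \in e)%:R)).
    by apply: eq_bigr => j _; rewrite !mxE.
  rewrite (bigD1 [set x; y]) //= (bigD1 [set y; z]) /=; last first.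
    rewrite (yz : [set y; z] \in E); apply/eqP=> /setP/(_ z); rewrite !inE eqxx orbT.
    by rewrite (negPf zNx) eq_sym (negPf yNz).
  rewrite (bigD1 [set z; x]) /=; last first.
    rewrite (zx : [set z; x] \in E) /=; apply/andP; split; apply/eqP=> /setP.
      by move/(_ z); rewrite !inE eqxx (negPf zNx) eq_sym (negPf yNz).
    by move/(_ x); rewrite !inE eqxx orbT (negPf xNy) eq_sym (negPf zNx).
  rewrite big1 => [|e /andP[/andP[/andP[eE e1] e2] e3]]; last first.
    case sub: (_ \subset _); last by rewrite mul0r.
    have /cards2P[a [b [ab eab]]] : #|e| == 2%N by apply/eqP/sE.
    move: sub ab e1 e2 e3; rewrite eab subUset !sub1set !inE => /andP[].
    by move=> /orP[/orP[]|] /eqP-> /orP[/orP[]|] /eqP->;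
      rewrite ?eqxx ?[[set y; x]]setUC ?[[set z; y]]setUC ?[[set x; z]]setUC ?eqxx.
  have sub a b : a \in [set x; y; z] -> b \in [set x; y; z] -> [set a; b] \subset [set x; y; z].
    by move=> aD bD; rewrite subUset !sub1set aD bD.
  rewrite !sub ?inE ?eqxx ?orbT // !mul1r addr0.
  have [->|vx] := eqVneq v x.
    by rewrite (negPf xNy) [x == z]eq_sym (negPf zNx) orbT add0r F2_addxx.
  have [->|vy] := eqVneq v y; first by rewrite (negPf yNz) addr0 F2_addxx.
  by case: (v == z); rewrite /= add0r ?addr0 // F2_addxx.
have /submxP[u Cu] := cycle_boundary CN.
exists (fun v w => face_fun u v w != 0); split=> [v w|v w vw].
  by rewrite face_fun_step.
have [j jE] := edge_index vw.
rewrite -F2_add_neq0 -(mulmx_face u vw jE) -Cu mxE jE subUset !sub1set.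
by case: (_ && _).
Qed.

End Jordan.

(** * Faces and separating triangles of a triangulation *)

Section Triangulation.

Variables (T : finType) (P : {set {set T}}) (r : T -> {perm T}).
Hypothesis triP : triangulation P r.

Let sP : simple_graph P. Proof. by case: triP => _ []. Qed.
Let rotP : rotation_system P r. Proof. by case: triP => _ []. Qed.
Let sphP : spherical P r. Proof. by case: triP => _ []. Qed.
Let T_gt1 : 1 < #|T|. Proof. by case: triP => /ltnW. Qed.

Lemma corner_exists x y : exists c, corner P x y c.
Proof.
have [/existsP[c xc]|/existsPn iso] := boolP [exists c, adj P x c].
  by exists c; left.
by exists y; right.
Qed.

Lemma triangulation_connect x y : connect (adj P) x y.
Proof.
apply/negP=> /negP cxy.
have xy : x != y by apply: contraNneq cxy => ->.
have xyP : ~~ adj P x y by apply: contra cxy; apply: connect1.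
have [a cxa] := corner_exists x y; have [b cyb] := corner_exists y x.
case/negP: (xyP); case: triP => _ _ maxP; rewrite /adj.
have <- : [set x; y] |: P = P; last exact: setU11.
apply: (maxP _ (add_edge P r x y a b)); last exact: add_extension.
by split; [apply: add_simple | apply: add_rotation | apply: spherical_add_diff].
Qed.

(** Otherwise the chord [yw] could be drawn inside the face, at the corners where the darts [xy] and
    [zw] arrive, against maximality. *)
Lemma same_face_adj x y z w : adj P x y -> adj P z w ->
  (x, y) \in porbit (face_perm r) (z, w) -> y != w -> adj P y w.
Proof.
move=> xy zw xyzw yw; apply/negP=> /negP ywP; case/negP: (ywP).
have cyx : corner P y w x by left; rewrite adjC.
have cwz : corner P w y z by left; rewrite adjC.
case: triP => _ _ maxP; rewrite /adj.
have <- : [set y; w] |: P = P; last exact: setU11.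
apply: (maxP _ (add_edge P r y w x z)); last exact: add_extension.
split; [by apply: add_simple | by apply: add_rotation |].
apply: (spherical_add_same rotP yw ywP cyx cwz) => //; try by rewrite adjC.
exact: triangulation_connect.
Qed.

Let mem_step x y : (y, r y x) \in porbit (face_perm r) (x, y).
Proof. by rewrite -face_permE perm_porbit. Qed.

Lemma closed_set_full (A : {set T}) x : x \in A ->
  (forall y z, y \in A -> adj P y z -> z \in A) -> A = setT.
Proof.
move=> xA clA; apply/setP=> y; rewrite inE.
have /connectP[p] := triangulation_connect x y.
elim: p x xA => [x xA _ -> //|z p IH x xA] /= /andP[xz zp] yE.
exact: IH (clA _ _ xA xz) zp yE.
Qed.

Lemma rotation_single x y z : adj P x y -> r x y = y -> adj P x z -> z = y.
Proof. by move=> xy rxy xz; apply: (rotation_ind (Q := eq^~ y) rotP xy xz) => // w _ ->. Qed.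

(** Otherwise [y] has degree 1 and the face turns back at [y]; maximality then joins [y] to the next
    neighbour of [x], unless [x] and [y] are the only vertices. *)
Lemma face_step_neq x y : adj P x y -> r y x != x.
Proof.
move=> xy; apply/eqP=> ryx; have yx : adj P y x by rewrite adjC.
have Ny z := @rotation_single y x z yx ryx.
have xw := rotation_adj rotP xy; set w := r x y in xw.
have [wy|wy] := eqVneq w y.
  have Nx z := @rotation_single x y z xy wy.
  have TE : [set x; y] = setT.
    apply: (@closed_set_full _ x) => [|p q]; rewrite !inE ?eqxx // => /orP[]/eqP->.
      by move/Nx->; rewrite eqxx orbT.
    by move/Ny->; rewrite eqxx.
  by case: triP; rewrite -cardsT -TE cards2; case: (x != y).
have := same_face_adj xw xy; rewrite wy => wyP.
have: adj P w y.
  apply: wyP => //; rewrite -/w.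
  have /eqP <- : porbit (face_perm r) (y, x) == porbit (face_perm r) (x, y).
    by rewrite eq_porbit_mem -[X in (_, X)]ryx mem_step.
  exact: mem_step.
by rewrite adjC => /Ny wx; have := adj_neq sP xw; rewrite wx eqxx.
Qed.

(* If a face has consecutive vertices x, y, z, w with w <> x, then maximality makes xz
   and yw edges, but the 3-cycle xyz would separate y from w near this face. *)
Lemma triangle_face x y : adj P x y -> r (r y x) y = x.
Proof.
move=> xy; set z := r y x; set w := r z y.
have yz : adj P y z by rewrite rotation_adj // adjC.
have zw : adj P z w by rewrite rotation_adj // adjC.
apply/eqP; rewrite -/w; apply: contraT => wx.
have zx : z != x by apply: face_step_neq.
have wy : w != y by apply: face_step_neq.
have xNy := adj_neq sP xy.
have faceE d : d \in porbit (face_perm r) (x, y) ->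
  porbit (face_perm r) d = porbit (face_perm r) (x, y).
  by move=> dO; apply/eqP; rewrite eq_porbit_mem.
have yzO := mem_step x y; rewrite -/z in yzO.
have zwO : (z, w) \in porbit (face_perm r) (x, y) by rewrite -(faceE _ yzO) mem_step.
have zxP : adj P z x.
  (* The dart [(p, x)] precedes [(x, y)] on the face, so [z] and [x] are both heads of darts of this
     face. *)
  pose p := ((r x)^-1)%g y; have rp : r x p = y by rewrite permKV.
  have xp : adj P x p.
    suff: p \in porbit (r x) y by rewrite rotP // inE.
    by rewrite -rp porbit_permE porbit_id.
  apply: (@same_face_adj y z p x) => //; first by rewrite adjC.
  suff -> : porbit (face_perm r) (p, x) = porbit (face_perm r) (x, y) by [].
  by apply: faceE; rewrite porbit_sym -{1}rp mem_step.
have wyP : adj P w y.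
  by apply: (@same_face_adj z w x y).
have addF (b c : bool) : b (+) c = false -> b = c by case: b c => [] [].
have [s [sf sr]] := jordan_triangle sP rotP triangulation_connect T_gt1 sphP xy yz zxP.
pose D := [set x; y; z]; rewrite -/D in sr.
have wD : w \notin D.
  by rewrite !inE (negPf wx) (negPf wy) eq_sym (negPf (adj_neq sP zw)).
have yw : adj P y w by rewrite adjC.
(* Around [w], which is off the 3-cycle, [s] is constant. Around [y] it changes only across [yx] and
   [yz]; these are consecutive, so every dart leaving [y] except [yz] carries the value opposite to
   that of the face of [xy]. *)
have sw v : adj P w v -> s v w = s z w.
  move=> wv; apply: (rotation_ind (Q := fun v => s v w = s z w) rotP _ wv) => //.
    by rewrite adjC.
  move=> q wq <-; have := sr w (r w q) (rotation_adj rotP wq).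
  by rewrite (negPf wD) -sf => /addF <-.
have sy v : adj P y v -> v != z -> s y v = ~~ s x y.
  move=> yv; apply: (rotation_ind (Q := fun v => v != z -> s y v = ~~ s x y) rotP yz yv).
    by rewrite eqxx.
  move=> q yq IH qz; rewrite -sf; have := sr y q yq.
  have [->|qNz] := eqVneq q z.
    by rewrite !inE !eqxx !orbT -sf => /addbP ->.
  have qNx : q != x by apply: contraNneq qz => ->.
  have qNy : q != y by rewrite eq_sym (adj_neq sP yq).
  by rewrite !inE (negPf qNx) (negPf qNy) (negPf qNz) andbF => /addF <-; apply: IH.
(* The dart [zw] belongs to the face of [xy], so [yw] would carry both values. *)
have := sw y wyP; rewrite sy //; last by rewrite eq_sym (adj_neq sP zw).
by rewrite -(sf y z) -(sf x y); case: (s x y).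
Qed.

Lemma triangle_face_adj x y : adj P x y -> adj P (r y x) x.
Proof.
move=> xy; rewrite -{2}(triangle_face xy) rotation_adj // adjC rotation_adj //.
by rewrite adjC.
Qed.

Lemma adj_sym x y : adj P x y -> adj P y x. Proof. by rewrite adjC. Qed.

Lemma triangle_face_inv x y : adj P x y -> r x (r y x) = y.
Proof.
move=> xy; have yz : adj P y (r y x) by rewrite rotation_adj // adjC.
by have := triangle_face yz; rewrite (triangle_face xy).
Qed.

Lemma three_cycle_adj (D : {set T}) x y : D \in three_cycles P -> x \in D -> y \in D -> x != y ->
  adj P x y.
Proof.
by rewrite inE => /andP[_ /forall_inP cl] xD yD; move/cl/forall_inP/(_ y yD)/implyP: xD; apply.
Qed.

Lemma card_set3 (x y z : T) : x != y -> y != z -> z != x -> #|[set x; y; z]| = 3.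
Proof.
move=> xy yz zx; rewrite setUC cardsU1 cards2 xy !inE negb_or zx.
by rewrite (eq_sym z) yz.
Qed.

Lemma mem_three_cycles x y z : adj P x y -> adj P y z -> adj P z x ->
  [set x; y; z] \in three_cycles P.
Proof.
move=> xy yz zx; rewrite inE card_set3 ?(adj_neq sP) //=.
apply/forall_inP=> a; rewrite !inE => aD; apply/forall_inP=> b; rewrite !inE => bD.
apply/implyP; move: aD bD.
by move=> /orP[/orP[]|] /eqP-> /orP[/orP[]|] /eqP->; rewrite ?eqxx // adjC.
Qed.

(** * The sides of a 3-cycle *)

Definition adj_off (D : {set T}) : rel T :=
  fun x y => [&& adj P x y, x \notin D & y \notin D].

(* Linked vertices lie in the same component of P - D; a vertex of D is linked to
   itself only. *)
Definition linked D := connect (adj_off D).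

Definition separating (D : {set T}) : bool :=
  (D \in three_cycles P) &&
  [exists x, exists y, [&& x \notin D, y \notin D & ~~ linked D x y]].

Lemma linked_sym D x y : linked D x y = linked D y x.
Proof.
apply: sym_connect_sym => {}x {}y.
by rewrite /adj_off adjC andbA [_ && (y \notin D)]andbAC -andbA.
Qed.

Lemma linked_ind (D : {set T}) (Q : T -> Prop) x y : x \notin D -> linked D x y -> Q x ->
  (forall v w, adj P v w -> v \notin D -> w \notin D -> Q v -> Q w) -> Q y.
Proof.
move=> xD /connectP[p]; elim: p x xD => [x _ _ -> //|z p IH x xD] /= /andP[].
case/and3P=> xz _ zD zp yE Qx step.
exact: (IH z zD zp yE (step _ _ xz xD zD Qx) step).
Qed.

Lemma linked_notin (D : {set T}) x y : x \notin D -> linked D x y -> y \notin D.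
Proof. by move=> xD xy; apply: (linked_ind (Q := fun y => y \notin D) xD xy). Qed.

Lemma linked1 (D : {set T}) x y : adj P x y -> x \notin D -> y \notin D -> linked D x y.
Proof. by move=> xy xD yD; apply: connect1; rewrite /adj_off xy xD. Qed.

Lemma linked_trans D x y z : linked D x y -> linked D y z -> linked D x z.
Proof. exact: connect_trans. Qed.

Lemma linked_adj (D : {set T}) x y z : x \notin D -> linked D x y -> adj P y z -> z \notin D -> linked D x z.
Proof.
move=> xD xy yz zD; apply: (linked_trans xy (linked1 yz _ zD)); exact: linked_notin xy.
Qed.

(** The indicator [s] from [jordan_triangle] has the same value on all darts entering a vertex off
    [D], and linked vertices share this value. The vertices opposite [xy] on its two faces get
    different values, since [xy] is on the 3-cycle. *)
Lemma nonface_separating x y z : adj P x y -> adj P y z -> adj P z x ->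
  z != r x y -> z != r y x -> separating [set x; y; z].
Proof.
move=> xy yz zx zxy zyx; rewrite /separating mem_three_cycles //=.
have [s [sf sr]] := jordan_triangle sP rotP triangulation_connect T_gt1 sphP xy yz zx.
set D := [set x; y; z] in sr *.
have addF (b c : bool) : b (+) c = false -> b = c by case: b c => [] [].
have srD v w : adj P v w -> v \notin D -> s v w = s w v.
  by move=> vw vD; apply: addF; rewrite sr // (negPf vD).
have local v w w' : v \notin D -> adj P v w -> adj P v w' -> s w v = s w' v.
  move=> vD vw vw'; apply: (rotation_ind (Q := fun w' => s w v = s w' v) rotP vw vw') => //.
  move=> q vq ->; rewrite sf srD //; exact: rotation_adj.
have glob v w v' w' : v \notin D -> linked D v w -> adj P v v' -> adj P w w' -> s v' v = s w' w.
  move=> vD vw vv' ww'.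
  suff: forall w', adj P w w' -> s v' v = s w' w by apply.
  apply: (linked_ind (Q := fun w => forall w', adj P w w' -> s v' v = s w' w) vD vw).
    by move=> q vq; apply: local.
  move=> p q pq pD qD IH u qu; rewrite (IH q) // srD // 1?adjC //.
  by apply: local => //; rewrite adjC.
have xyN := adj_neq sP xy.
have xa : adj P x (r x y) by apply: rotation_adj.
have yb : adj P y (r y x) by rewrite rotation_adj // adjC.
have ya : adj P y (r x y) by rewrite adjC triangle_face_adj // adjC.
have xb : adj P x (r y x) by rewrite adjC triangle_face_adj.
have aD : r x y \notin D.
  by rewrite !inE !negb_or -!(eq_sym z) zxy ![r x y == _]eq_sym !(adj_neq sP).
have bD : r y x \notin D.
  by rewrite !inE !negb_or -!(eq_sym z) zyx ![r y x == _]eq_sym !(adj_neq sP).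
apply/existsP; exists (r x y); apply/existsP; exists (r y x); rewrite aD bD /=.
apply/negP=> ab; have := glob _ _ x y aD ab.
rewrite !(adjC P (r _ _)) xa yb -!sf => /(_ isT isT) sxy.
by have := sr x y xy; rewrite sxy addbb !inE !eqxx orbT.
Qed.

(* The faces that meet the component of x have their boundary inside D; since every
   boundary is even at each vertex, it is empty or all of D, and it is not empty. *)
Lemma separating_apex (D : {set T}) x y a b : D \in three_cycles P ->
    x \notin D -> y \notin D -> ~~ linked D x y -> a \in D -> b \in D -> a != b ->
  linked D x (r a b) \/ linked D x (r b a).
Proof.
move=> D3 xD yD xy aD bD ab.
set K := linked D x.
(* The face of the dart [(v, w)] has the vertices [v], [w] and [r w v]: [s] says that it meets the
   component of [x]. *)
pose s v w := [|| K v, K w | K (r w v)].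
have sf v w : adj P v w -> s v w = s w (r w v).
  by move=> vw; rewrite /s triangle_face // orbC orbA.
have KD v w : adj P v w -> K w -> K v || (v \in D).
  move=> vw Kw; case: (boolP (v \in D)) => vD; rewrite ?orbT // orbF.
  by apply: linked_adj Kw _ vD => //; rewrite adjC.
have sD v w : adj P v w -> v \notin D -> s v w = s w v.
  move=> vw vD; rewrite /s; case Kv: (K v); rewrite ?orbT //.
  case Kw: (K w) => //=; case: (boolP (K (r w v))) => [Kz|_].
    have := KD v (r w v); rewrite Kv Kz (negPf vD) adjC triangle_face_adj //.
    by move/(_ isT isT).
  case: (boolP (K (r v w))) => [Kz|//].
  have := KD v (r v w); rewrite Kv Kz (negPf vD) rotation_adj //.
  by move/(_ isT isT).
have sDr v w : adj P v w -> w \notin D -> s v w = s w v.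
  by move=> vw wD; rewrite -sD // adjC.
have [c cD [ca cb]] : exists2 c, c \in D & c != a /\ c != b.
  have: D :\: [set a; b] != set0.
    apply/eqP=> D0; move: D3; rewrite inE -(cardsID [set a; b]) D0 cards0 addn0.
    case/andP=> /eqP D3 _; have := subset_leq_card (subsetIr D [set a; b]).
    by rewrite D3 cards2; case: (_ != _).
  by case/set0Pn=> c; rewrite !inE negb_or => /andP[/andP[? ?] ?]; exists c.
have DE v : v \in D -> [|| v == a, v == b | v == c].
  move=> vD; have : [set a; b; c] == D.
    rewrite eqEcard !subUset !sub1set aD bD cD /= card_set3 // 1?eq_sym //.
    by move: D3; rewrite inE => /andP[/eqP-> _].
  by move/eqP=> E; move: vD; rewrite -E !inE orbA.
have even u v w : u \in D -> v \in D -> w \in D -> u != v -> v != w -> w != u ->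
    s v u (+) s u v = s w u (+) s u w.
  move=> uD vD wD uv vw wu.
  have uE q : q \in D -> q != u -> (q == v) || (q == w).
    move=> qD qu; have : [set u; v; w] == D.
      rewrite eqEcard !subUset !sub1set uD vD wD /= card_set3 //.
      by move: D3; rewrite inE => /andP[/eqP-> _].
    by move/eqP=> E; move: qD; rewrite -E !inE (negPf qu).
  (* Each face at [u] has one dart entering and one dart leaving [u]. The terms of neighbours off
     [D] cancel, which leaves the parity statement for the two edges of [D] at [u]. *)
  have E : \sum_(q | adj P u q) s q u = \sum_(q | adj P u q) s u q.
    rewrite [RHS](reindex_inj (@perm_inj _ (r u))) /=.
    rewrite [RHS](eq_bigl (adj P u)) => [|q]; last first.
      have NE : (porbit (r u) (r u q) == porbit (r u) q) by rewrite porbit_permE.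
      apply/idP/idP=> uq; last exact: rotation_adj.
      have: q \in porbit (r u) (r u q) by rewrite porbit_permE porbit_id.
      by rewrite rotP // inE.
    by apply: eq_bigr => q uq; rewrite sf // adjC.
  have uvP : adj P u v by apply: three_cycle_adj D3 _ _ _.
  have uwP : adj P u w by apply: (three_cycle_adj D3) => //; rewrite eq_sym.
  move: E; rewrite (bigD1 v) // (bigD1 w) /=; last by rewrite uwP eq_sym.
  rewrite [in RHS](bigD1 v) // [in RHS](bigD1 w) /=; last by rewrite uwP eq_sym.
  rewrite (eq_bigr (fun q => nat_of_bool (s u q))) => [|q /andP[/andP[uq qv] qw]]; last first.
    rewrite sD ?(adjC P q) //; apply/negP=> /uE.
    by rewrite eq_sym (adj_neq sP uq) (negPf qv) (negPf qw) => /(_ isT).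
  rewrite !addnA => /addIn.
  by case: (s v u); case: (s w u); case: (s u v); case: (s u w).
have abP := three_cycle_adj D3 aD bD ab.
(* If the boundary missed [ab], then by [even] it would miss all of [D], and [s] would be constant,
   although it holds at the darts of [x] and fails at those of [y]. *)
have sab : s a b (+) s b a.
  apply/negPn/negP=> /negbTE ab0.
  have ac0 : s c a (+) s a c = false by rewrite -(even a b c) // 1?eq_sym // addbC.
  have bc0 : s c b (+) s b c = false by rewrite -(even b a c) // eq_sym.
  have sr v w : adj P v w -> s v w = s w v.
    move=> vw; have vwN := adj_neq sP vw; move: ab0 ac0 bc0.
    have addF (p q : bool) : p (+) q = false -> p = q by case: p q => [] [].
    case: (boolP (v \in D)) => [/DE vD|/sD -> //].
    case: (boolP (w \in D)) => [/DE wD|wD _ _ _]; last by rewrite -sD // adjC.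
    move=> /addF ? /addF ? /addF ?; move: vD wD vwN.
    by do 2![case/or3P => /eqP->]; rewrite ?eqxx.
  have [x' xx'] := exists_adj triangulation_connect T_gt1 x.
  have [y' yy'] := exists_adj triangulation_connect T_gt1 y.
  have := dart_constant rotP triangulation_connect sf sr xx' yy'.
  rewrite /s /K /linked connect0 /= => /esym/or3P[].
  - exact/negP.
  - by move/(KD _ _ yy'); rewrite (negPf yD) orbF; apply/negP.
  - move=> Ky; have := KD y _ _ Ky; rewrite (negPf yD) orbF adjC triangle_face_adj //.
    by move/(_ isT); apply/negP.
have notK v : v \in D -> K v = false.
  by move=> vD; apply/negP=> /(linked_notin xD); rewrite vD.
by move: sab; rewrite /s !(notK a) ?(notK b) //=; case: (K (r a b)); case: (K (r b a)) => //; by [left|right].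
Qed.

(** The triangles [x a b] and [x a c] do not separate, so they are the two faces at [xa], and one of
    [b], [c] follows [a] around [x]: [A] is closed under the rotation. Neighbourhoods are determined
    in this way below. *)
Lemma link_closed x (A : {set T}) : A != set0 ->
    {in A, forall a, adj P x a} ->
    {in A, forall a, exists b c, [/\ b \in A /\ c \in A, b != c, adj P a b, adj P a c &
       ~~ separating [set x; a; b] /\ ~~ separating [set x; a; c]]} ->
  [set y | adj P x y] = A.
Proof.
case/set0Pn=> a aA xA cl; apply/setP=> y; rewrite inE; apply/idP/idP => [xy|/xA //].
apply: (rotation_ind (Q := fun y => y \in A) rotP (xA a aA) xy aA) => v xv vA.
have [b [c [[bA cA] bc vb vc [nb nc]]]] := cl v vA.
have key w : adj P v w -> w \in A -> ~~ separating [set x; v; w] -> w = r x v \/ w = r v x.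
  move=> vw wA; have [->|wx] := eqVneq w (r x v); first by left.
  have [->|wv] := eqVneq w (r v x); first by right.
  by rewrite nonface_separating // adjC xA.
have [<- //|bE] := key b vb bA nb; have [<- //|cE] := key c vc cA nc.
by rewrite bE cE eqxx in bc.
Qed.

Hypothesis T_gt3 : 3 < #|T|.

(** If both faces at [xy] had the same third vertex, then [x], [y] and this vertex would have no
    other neighbours and, by connectedness, would be all of [T]. *)
Lemma apex_neq x y : adj P x y -> r x y != r y x.
Proof.
move=> xy; have yx := adj_sym xy; apply/eqP=> zz.
have xz := rotation_adj rotP xy.
suff TE : [set x; y; r x y] = setT.
  move: T_gt3; rewrite -cardsT -TE setUC cardsU1 cards2.
  by case: (_ \notin _); case: (_ != _).
set z := r x y in zz xz *.
have xzy : r x z = y by rewrite zz triangle_face_inv.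
have yzx : r y z = x by apply: triangle_face_inv.
have zyx : r z y = x by rewrite zz triangle_face.
have zxy : r z x = y by apply: triangle_face.
have two u v w : adj P u v -> r u v = w -> r u w = v ->
    forall q, adj P u q -> (q == v) || (q == w).
  move=> uv uvw uwv q uq.
  apply: (rotation_ind (Q := fun q => (q == v) || (q == w)) rotP uv uq) => [|p _].
    by rewrite eqxx.
  by case/orP=> /eqP->; rewrite ?uvw ?uwv eqxx ?orbT.
apply: (@closed_set_full _ x) => [|p q]; rewrite !inE ?eqxx // => /orP[/orP[]|]/eqP->.
- by move/(two x y z xy erefl xzy)/orP=> []->; rewrite ?orbT.
- by move/(two y x z yx (esym zz) yzx)/orP=> []->; rewrite ?orbT.
have zyP : adj P z y by apply: triangle_face_adj.
by move/(two z y x zyP zyx zxy)/orP=> []->; rewrite ?orbT.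
Qed.

Lemma common_neighbours x y : adj P x y ->
  exists z w, [/\ z != w, adj P x z, adj P y z, adj P x w & adj P y w].
Proof.
move=> xy; have yx := adj_sym xy; exists (r x y), (r y x).
have yz := adj_sym (triangle_face_adj yx); have xw := adj_sym (triangle_face_adj xy).
by split=> //; [exact: apex_neq | exact: rotation_adj | exact: rotation_adj].
Qed.

(** Only two of the three can lie opposite [xy] on a face; the remaining one forms a 3-cycle with
    [xy] that is not a face. *)
Lemma common_neighbours_le2 x y z1 z2 z3 : adj P x y ->
    {in [:: z1; z2; z3], forall z, adj P x z && adj P y z} -> uniq [:: z1; z2; z3] ->
  exists2 z, z \in [:: z1; z2; z3] & separating [set x; y; z].
Proof.
move=> xy zz uz.
have key z : z \in [:: z1; z2; z3] -> z != r x y -> z != r y x -> separating [set x; y; z].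
  by move=> /zz /andP[xz yz] *; apply: nonface_separating => //; rewrite adjC.
have [z zin /andP[z1' z2']] : exists2 z, z \in [:: z1; z2; z3] & (z != r x y) && (z != r y x).
  apply/hasP; apply: contraT => /hasPn nn.
  have : #|[set z1; z2; z3]| <= #|[set r x y; r y x]|.
    apply: subset_leq_card; apply/subsetP=> z; rewrite !inE => zin.
    have := nn z; rewrite !inE orbA => /(_ zin).
    by rewrite negb_and !negbK.
  move: uz; rewrite /= !inE negb_or -!andbA => /and4P[z12 z13 z23 _].
  by rewrite card_set3 1?(eq_sym z3) // cards2; case: (_ != _).
by exists z => //; apply: key.
Qed.

End Triangulation.

Lemma card3_third (T : finType) (C : {set T}) x y : #|C| = 3 -> x \in C -> y \in C -> x != y ->
  exists z, [/\ z != x, z != y & C = [set x; y; z]].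
Proof.
move=> C3 xC yC xy.
have : #|C :\ x :\ y| = 1.
  by have := cardsD1 y (C :\ x); have := cardsD1 x C; rewrite C3 !inE eq_sym xy xC yC; lia.
move/eqP/cards1P=> [z E]; have : z \in C :\ x :\ y by rewrite E inE.
rewrite !inE => /and3P[zy zx zC]; exists z; split=> //.
apply/esym/eqP; rewrite eqEcard !subUset !sub1set xC yC zC C3.
by rewrite card_set3 // eq_sym.
Qed.

Lemma card_set3_le (T : finType) (x y z : T) : #|[set x; y; z]| <= 3.
Proof. by rewrite setUC cardsU1 cards2; case: (_ \notin _); case: (_ != _). Qed.

Lemma set2_eq (T : finType) (x y u v : T) : [set u; v] = [set x; y] -> u = x /\ v = y \/ u = y /\ v = x.
Proof.
move=> E; have: u \in [set x; y] by rewrite -E !inE eqxx.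
have: v \in [set x; y] by rewrite -E !inE eqxx orbT.
have: x \in [set u; v] by rewrite E !inE eqxx.
have: y \in [set u; v] by rewrite E !inE eqxx orbT.
rewrite !inE => /orP[]/eqP y1 /orP[]/eqP x1 /orP[]/eqP v1 /orP[]/eqP u1; subst; auto.
Qed.

(** * Isomorphisms from tables of edges *)

Section Tables.

Variables (T : finType) (x0 : T) (n : nat) (s : seq T).
Hypotheses (size_s : size s = n.+1) (uniq_s : uniq s) (all_s : forall x, x \in s).
Implicit Types l : seq (nat * nat).

Definition listed l : {set {set T}} :=
  [set:: [seq [set nth x0 s p.1; nth x0 s p.2] | p <- l]].

Let f x : 'I_n.+1 := inord (index x s).

Lemma index_lt x : index x s < n.+1.
Proof. by rewrite -size_s index_mem. Qed.

Lemma label_bij : bijective f.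
Proof.
exists (fun i : 'I_n.+1 => nth x0 s i) => [x|i]; first by rewrite inordK ?index_lt // nth_index.
by rewrite /f index_uniq ?size_s // inord_val.
Qed.

Lemma imset_listed l : all (fun p => (p.1 <= n) && (p.2 <= n)) l ->
  [set f @: e | e : {set T} in listed l] = edge_set n l.
Proof.
move=> /allP bd; have fp p : p \in l ->
    f @: [set nth x0 s p.1; nth x0 s p.2] = [set inord p.1; inord p.2].
  by move=> /bd /andP[p1 p2]; rewrite imsetU1 imset_set1 /f !index_uniq // size_s.
apply/setP=> e; rewrite [RHS]inE; apply/imsetP/mapP => [[e']|[p pl ->]].
  by rewrite inE => /mapP[p pl ->] ->; exists p => //; apply: fp.
exists [set nth x0 s p.1; nth x0 s p.2]; last by rewrite fp.
by rewrite inE; apply/mapP; exists p.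
Qed.

Definition complete_table l :=
  all (fun i => all (fun j => [|| i == j, (i, j) \in l | (j, i) \in l]) (iota 0 n.+1))
      (iota 0 n.+1).

(** Listing the non-edges in [l'] too reduces the equality to checks of single pairs, as every pair
    of vertices occurs in one of the two lists. *)
Lemma graph_listed (P : {set {set T}}) l l' : simple_graph P ->
    complete_table (l ++ l') ->
    all (fun p => adj P (nth x0 s p.1) (nth x0 s p.2)) l ->
    all (fun p => ~~ adj P (nth x0 s p.1) (nth x0 s p.2)) l' ->
  P = listed l.
Proof.
move=> sP /allP tab /allP yes /allP no; apply/setP=> e; rewrite [RHS]inE.
apply/idP/mapP => [eP|[p pl ->]]; last exact: yes.
have /cards2P[x [y [xy eE]]] : #|e| == 2 by apply/eqP/sP.
have xyP : adj P x y by rewrite /adj -eE.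
have idx z : index z s \in iota 0 n.+1 by rewrite mem_iota /= add0n index_lt.
have /allP/(_ _ (idx y)) := tab _ (idx x).
have sx z : nth x0 s (index z s) = z by rewrite nth_index.
case/or3P => [/eqP E|xyl|yxl].
- by case/eqP: xy; rewrite -(sx x) E sx.
- move: xyl; rewrite mem_cat => /orP[xyl|/no]; last by rewrite /= !sx xyP.
  by exists (index x s, index y s); rewrite //= !sx.
- move: yxl; rewrite mem_cat => /orP[xyl|/no]; last by rewrite /= !sx adjC xyP.
  by exists (index y s, index x s); rewrite //= !sx setUC.
Qed.

Lemma braced_iso_table (P B : {set {set T}}) l l' b : simple_graph P ->
    all (fun p => (p.1 <= n) && (p.2 <= n)) (l ++ b) ->
    complete_table (l ++ l') ->
    all (fun p => adj P (nth x0 s p.1) (nth x0 s p.2)) l ->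
    all (fun p => ~~ adj P (nth x0 s p.1) (nth x0 s p.2)) l' ->
    B = listed b ->
  braced_iso P B (edge_set n l) (edge_set n b).
Proof.
rewrite all_cat => sP /andP[bl bb] tab yes no BE.
exists f; split; first exact: label_bij.
  by rewrite (graph_listed sP tab yes no) imset_listed.
by rewrite BE imset_listed.
Qed.

End Tables.

Lemma mem_edge_set n l i j : all (fun p => (p.1 <= n) && (p.2 <= n)) l -> i <= n -> j <= n ->
  ([set inord i; inord j] \in edge_set n l) = ((i, j) \in l) || ((j, i) \in l).
Proof.
move=> /allP bd ni nj; rewrite inE.
have inj a b : a <= n -> b <= n -> inord a = inord b :> 'I_n.+1 -> a = b.
  by move=> na nb /(congr1 val); rewrite /= !inordK.
apply/mapP/orP => [[[a b] pl E]|[pl|pl]].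
- have /andP[/= na nb] := bd _ pl.
  have [[/inj ia /inj jb]|[/inj ib /inj ja]] := set2_eq E.
    by left; rewrite ia // jb.
  by right; rewrite ja // ib.
- by exists (i, j).
by exists (j, i); rewrite // setUC.
Qed.

Lemma P_I_edges : P_I = edge_set 5 [:: (0, 1); (0, 2); (0, 4); (0, 5); (1, 2); (1, 3);
  (1, 5); (2, 3); (2, 4); (3, 4); (3, 5); (4, 5)].
Proof.
apply/setP=> e; rewrite [LHS]inE [in LHS]inE andbC.
case: (boolP (#|e| == 2)) => e2 /=; last first.
  apply/esym/negbTE/negP; rewrite inE => /mapP[p pl E]; case/negP: e2; rewrite E cards2.
  rewrite -(inj_eq val_inj) /=; move: pl; rewrite !inE.
  by do !case/orP=> [/eqP->|]; try (by rewrite !inordK); move/eqP->; rewrite !inordK.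
have /cards2P[x [y [xy ->]]] := e2.
have xy' : val x != val y by [].
rewrite -[x]inord_val -[y]inord_val !mem_edge_set ?leq_ord //.
case: x y xy' {xy} => [[|[|[|[|[|[|//]]]]]] ?] [[|[|[|[|[|[|//]]]]]] ?] //=.
Qed.

(** * Irreducible braced triangulations *)

Section Braced.

Variables (T : finType) (P : {set {set T}}) (r : T -> {perm T}) (B : {set {set T}}).
Hypotheses (brP : braced_triangulation P r B) (irr : irreducible P B) (B2 : #|B| = 2).

Let triP : triangulation P r. Proof. by case: brP. Qed.
Let sP : simple_graph P. Proof. by case: triP => _ []. Qed.

Notation "x -- y" := (adj P x y) (at level 30).
Notation "x ~~~ y" := (adj B x y) (at level 30).
Local Notation G := (P :|: B).

Lemma brace_neq x y : x ~~~ y -> x != y.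
Proof.
by case: brP => _ Bb /Bb[]; rewrite cards2; case: (x != y).
Qed.

Lemma brace_nadj x y : x ~~~ y -> x -- y = false.
Proof. by case: brP => _ Bb /Bb[_ /negPf]. Qed.

Lemma adj_neqP x y : x -- y -> x != y. Proof. exact: adj_neq. Qed.

Lemma adj_braced x y : adj G x y = x -- y || x ~~~ y.
Proof. by rewrite /adj in_setU. Qed.

Lemma brace_cases x y : x ~~~ y -> exists p q, [/\ p ~~~ q, [set p; q] != [set x; y] &
  forall u v, u ~~~ v -> [set u; v] = [set x; y] \/ [set u; v] = [set p; q]].
Proof.
move=> xy; have : #|B :\ [set x; y]| = 1 by move: B2; rewrite (cardsD1 [set x; y]) (xy : [set x; y] \in B) => -[].
move/eqP/cards1P=> [b E]; have : b \in B :\ [set x; y] by rewrite E inE.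
rewrite !inE => /andP[bxy bB]; case: brP => _ Bb; have [b2 _] := Bb b bB.
have /cards2P[p [q [pq bE]]] : #|b| == 2 by apply/eqP.
exists p, q; rewrite /adj -bE; split=> // u v uv.
have [->|n] := eqVneq [set u; v] [set x; y]; [by left|right].
by apply/eqP; rewrite -in_set1 -E !inE n.
Qed.

Lemma brace_exists : exists x y, x ~~~ y.
Proof.
have /card_gt0P[b bB] : 0 < #|B| by rewrite B2.
case: brP => _ Bb; have [b2 _] := Bb b bB.
have /cards2P[p [q [pq bE]]] : #|b| == 2 by apply/eqP.
by exists p, q; rewrite /adj -bE.
Qed.

Lemma T_gt3 : 3 < #|T|.
Proof.
have [p [q pq]] := brace_exists.
have T1 : 1 < #|T| by case: triP => /ltnW.
have [x px] := exists_adj (triangulation_connect triP) T1 p.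
have zp := triangle_face_adj triP px; set z := r x p in zp.
have xz : x -- z by rewrite (rotation_adj _) //; [case: triP => _ [] | exact: adj_sym].
have qN : q \notin [set p; x; z].
  rewrite !inE !negb_or eq_sym brace_neq //=.
  apply/andP; split; apply/eqP=> qE; move: (brace_nadj pq); rewrite qE ?px //.
  by rewrite adjC zp.
have := max_card (mem (q |: [set p; x; z])).
by rewrite cardsU1 qN (card_set3 (adj_neqP px) (adj_neqP xz) (adj_neqP zp)).
Qed.

Local Notation sep := (separating P).
Local Notation link := (linked P).
Definition nbrs x := [set y | x -- y].

Lemma covered x y : x -- y -> (forall D, sep D -> x \in D -> y \in D -> False) ->
  exists z, [/\ adj G x z, adj G y z & x ~~~ z \/ y ~~~ z].
Proof.
move=> xy nosep; have xNy := adj_neqP xy.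
have [z [w [zw xz yz xw yw]]] := common_neighbours triP T_gt3 xy.
have contr : contractible P [set x; y].
  have -> : contractible P [set x; y] = (#|[set [set x; y; z]; [set x; y; w]]| == 2).
    congr (_ == _); apply: eq_card => C; rewrite [LHS]inE [RHS]inE !in_set1.
    apply/andP/orP => [[C3 sub]|[]/eqP->]; last first.
    - by rewrite subsetUl (mem_three_cycles triP) // adj_sym.
    - by rewrite subsetUl (mem_three_cycles triP) // adj_sym.
    move: sub; rewrite subUset !sub1set => /andP[xC yC].
    have Cc : #|C| = 3 by move: C3; rewrite inE => /andP[/eqP].
    have [u [ux uy CE]] := card3_third Cc xC yC xNy.
    have uC : u \in C by rewrite CE !inE eqxx !orbT.
    have xu : x -- u by apply: three_cycle_adj C3 xC uC _; rewrite eq_sym.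
    have yu : y -- u by apply: three_cycle_adj C3 yC uC _; rewrite eq_sym.
    rewrite CE; have [->|uz] := eqVneq u z; first by left.
    have [->|uw] := eqVneq u w; first by right.
    (* A third common neighbour of [x] and [y] would put [xy] into a separating triangle. *)
    have [||v _ /nosep] := @common_neighbours_le2 _ _ _ triP x y z w u xy.
    - by move=> v; rewrite !inE => /or3P[]/eqP->; apply/andP.
    - by rewrite /= !inE negb_or zw !(eq_sym _ u) uz uw.
    by rewrite !inE !eqxx orbT => /(_ isT isT).
  rewrite cards2; have -> // : [set x; y; z] != [set x; y; w].
  apply/eqP=> /setP/(_ z); rewrite !inE eqxx (negPf zw) orbT orbF.
  by rewrite eq_sym (negPf (adj_neqP xz)) eq_sym (negPf (adj_neqP yz)).
have := irr xy; rewrite /braced_contractible contr /= negbK.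
case/existsP=> C /andP[C3 /andP[sub /existsP[b /andP[bB bC]]]].
have Cc : #|C| = 3 by move: C3; rewrite inE => /andP[/eqP].
move: sub; rewrite subUset !sub1set => /andP[xC yC].
have [u [ux uy CE]] := card3_third Cc xC yC xNy.
have uC : u \in C by rewrite CE !inE eqxx !orbT.
exists u; split.
- by apply: three_cycle_adj C3 xC uC _; rewrite eq_sym.
- by apply: three_cycle_adj C3 yC uC _; rewrite eq_sym.
case: brP => _ Bb; have [b2 bP] := Bb b bB.
have /cards2P[p [q [pq bE]]] : #|b| == 2 by apply/eqP.
move: bC bB bP pq; rewrite bE CE subUset !sub1set !inE => /andP[].
rewrite -/(adj B p q) -/(adj P p q).
move=> /orP[/orP[]|]/eqP-> /orP[/orP[]|]/eqP-> uv nuv; rewrite ?eqxx // => _.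
all: try by [left|right]; try by [left; rewrite adjC|right; rewrite adjC].
- by rewrite xy in nuv.
- by rewrite adjC xy in nuv.
Qed.

(** * Sides of separating triangles *)

Lemma sep_cycle D : sep D -> D \in three_cycles P. Proof. by case/andP. Qed.

Lemma sep_card D : sep D -> #|D| = 3.
Proof. by move/sep_cycle; rewrite inE => /andP[/eqP]. Qed.

Lemma sep_adj D x y : sep D -> x \in D -> y \in D -> x != y -> x -- y.
Proof. by move/sep_cycle/three_cycle_adj; apply. Qed.

Lemma sep_neq (D : {set T}) a : sep D -> exists2 b, b \in D & b != a.
Proof.
move=> sD; have: 0 < #|D :\ a| by have := cardsD1 a D; rewrite sep_card //; case: (a \in D); lia.
by case/card_gt0P=> b; rewrite !inE => /andP[ba bD]; exists b.
Qed.

Lemma sep_other D x : sep D -> x \notin D -> exists2 y, y \notin D & ~~ link D x y.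
Proof.
case/andP=> _ /existsP[y /existsP[z /and3P[yD zD yz]]] xD.
have [xy|xy] := boolP (link D x y); last by exists y.
exists z => //; apply: contra yz; apply: linked_trans; by rewrite linked_sym.
Qed.

(** Both vertices opposite an edge [ab] of [D] are adjacent to [a], and one of them lies on the side
    of [x]. *)
Lemma sep_attach D x a : sep D -> x \notin D -> a \in D -> exists2 v, link D x v & a -- v.
Proof.
move=> sD xD aD; have [b bD ba] := sep_neq a sD.
have ab : a -- b by apply: (sep_adj sD) => //; rewrite eq_sym.
have [y yD xy] := sep_other sD xD.
have aNb : a != b by rewrite eq_sym.
have rotP : rotation_system P r by case: triP => _ [].
have [v|v] := separating_apex triP (sep_cycle sD) xD yD xy aD bD aNb.
  by exists (r a b) => //; apply: rotation_adj.
by exists (r b a) => //; rewrite adjC (triangle_face_adj triP).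
Qed.

(** Each side contains one of the two vertices opposite a fixed edge of [D], so three sides cannot
    be distinct. *)
Lemma sep_two D x y z : sep D -> x \notin D -> y \notin D -> z \notin D ->
  ~~ link D x y -> ~~ link D x z -> link D y z.
Proof.
move=> sD xD yD zD xy xz; apply: contraT => yz.
have /card_gt0P[a aD] : 0 < #|D| by rewrite sep_card.
have [b bD ba] := sep_neq a sD; have ab : a != b by rewrite eq_sym.
have yx : ~~ link D y x by rewrite linked_sym.
have zx : ~~ link D z x by rewrite linked_sym.
have C3 := sep_cycle sD.
have join u v w : ~~ link D u v -> link D u w -> link D v w -> false.
  move=> uv uw vw; rewrite -(negPf uv); apply: linked_trans uw _; by rewrite linked_sym.
have [hx|hx] := separating_apex triP C3 xD yD xy aD bD ab;
have [hy|hy] := separating_apex triP C3 yD xD yx aD bD ab;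
have [hz|hz] := separating_apex triP C3 zD xD zx aD bD ab;
by [have := join _ _ _ xy hx hy | have := join _ _ _ xz hx hz | have := join _ _ _ yz hy hz].
Qed.

Lemma linked_transfer (C D : {set T}) w v : w \notin C -> link C w v ->
  (forall u, link C w u -> u \notin D) -> link D w v.
Proof.
move=> wC wv wD; suff: link C w v /\ link D w v by case.
apply: (linked_ind (Q := fun v => link C w v /\ link D w v) wC wv) => [|p q pq pC qC [wp wp']].
  by split; apply: connect0.
have wq := linked_adj wC wp pq qC; split=> //.
apply: linked_adj (wp') pq _; first by apply: wD; apply: connect0.
exact: wD.
Qed.

(** [D] is a clique with a vertex on the side of [x], so it lies in this side and [C]. Choose [c] in
    [C] off [D]. Everything off [D] and outside the side of [x] is linked to [c] off [D], so the
    side of [D] not containing [c] lies within the side of [x]. *)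
Lemma sep_shrink C D x d : sep C -> sep D -> x \notin C -> link C x d -> d \in D ->
  exists2 y, y \notin D & forall z, link D y z -> link C x z.
Proof.
move=> sC sD xC xd dD; have dC := linked_notin xC xd.
have DC u : u \in D -> u \notin C -> link C x u.
  move=> uD uC; have [->//|ud] := eqVneq u d.
  by apply: (linked_adj xC xd) => //; apply: sep_adj sD _ _ _; rewrite // eq_sym.
have [c cC cD] : exists2 c, c \in C & c \notin D.
  apply/subsetPn; apply: contra dC => CD.
  have /eqP-> // : C == D by rewrite eqEcard CD !sep_card.
have toc w : w \notin D -> ~ link C x w -> link D c w.
  move=> wD xw; case: (boolP (w \in C)) => wC.
    have [->|cw] := eqVneq c w; first exact: connect0.
    by apply: linked1 => //; apply: sep_adj sC _ _ _.
  have [v wv cv] := sep_attach sC wC cC.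
  have wvD : link D w v.
    apply: (linked_transfer wC wv) => u wu; apply/negP=> uD; apply: xw.
    apply: linked_trans (DC u uD (linked_notin wC wu)) _; by rewrite linked_sym.
  by rewrite linked_sym; apply: linked_adj wD wvD _ cD; apply: adj_sym.
have [y yD cy] := sep_other sD cD; exists y => // z yz.
have zD := linked_notin yD yz.
apply/negPn/negP=> /negP xz; case/negP: cy; apply: linked_trans (toc z zD xz) _.
by rewrite linked_sym.
Qed.

(** * Innermost sides and tips *)

Definition inessential x := forall D, sep D -> x \notin D.

(** The vertex [x] merely selects a side of [D]. *)
Definition leaf D x := [/\ sep D, x \notin D & forall z, link D x z -> inessential z].

(** Induction on the size of the side: if a separating triangle meets it in [d], then [sep_shrink]
    gives a side of this triangle inside it, which is smaller because it misses [d]. *)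
Lemma leaf_exists D x : sep D -> x \notin D ->
  exists D' x', leaf D' x' /\ forall z, link D' x' z -> link D x z.
Proof.
have [n] := ubnP #|[set z | link D x z]|; elim: n D x => // n IH D x le sD xD.
have [/existsP[C /andP[sC /existsP[d /andP[dC xd]]]]|/existsPn noC] :=
    boolP [exists C, sep C && [exists d, (d \in C) && link D x d]].
  have [y yC sub] := sep_shrink sD sC xD xd dC.
  have [|D' [x' [lf sub']]] := IH C y _ sC yC.
    rewrite ltnS in le; apply: leq_trans le; apply/proper_card/properP; split.
      by apply/subsetP=> z; rewrite !inE => /sub.
    by exists d; rewrite !inE //; apply/negP=> /(linked_notin yC); rewrite dC.
  by exists D', x'; split=> // z /sub'/sub.
exists D, x; split=> //; split=> // z xz C sC; apply/negP=> zC.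
have := noC C; rewrite sC /= => /existsPn/(_ z); by rewrite zC xz.
Qed.

(** An edge [cv] from [D] into the side is covered. If the brace is [cz], then [z] is off [D], since
    [D] is a clique; so either [vz] is a brace as well or [z] is on the side of [v]. *)
Lemma leaf_touched D x : leaf D x -> exists p q, link D x p /\ p ~~~ q.
Proof.
case=> sD xD iness; have /card_gt0P[c cD] : 0 < #|D| by rewrite sep_card.
have [v xv cv] := sep_attach sD xD cD.
have [|z [vz cz]] := covered cv; first by move=> C /(iness v xv) vC _; rewrite (negPf vC).
case=> [cz'|vz']; last by exists v, z.
have [zD|zD] := boolP (z \in D).
  by have := brace_nadj cz'; rewrite (sep_adj sD) // brace_neq.
move: cz; rewrite adj_braced => /orP[vz'|]; last by exists v, z.
exists z, c; rewrite adjC; split=> //; exact: linked_adj xv vz' zD.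
Qed.

Lemma nbrs_irr x : x \notin nbrs x. Proof. by rewrite inE adj_irr. Qed.

Lemma linked_nbrs x z : link (nbrs x) x z -> z = x.
Proof.
move=> xz; apply: (linked_ind (Q := fun z => z = x) (nbrs_irr x) xz) => //.
by move=> v w vw _ wN vx; move: wN; rewrite inE -vx vw.
Qed.

(** Each neighbour of [x] shares two further neighbours with [x], so at most three neighbours must
    be exactly three, pairwise adjacent. *)
Lemma nbrs_three_cycle x : #|nbrs x| <= 3 -> nbrs x \in three_cycles P.
Proof.
move=> le; have T1 : 1 < #|T| by case: triP => /ltnW.
have [a xa] := exists_adj (triangulation_connect triP) T1 x.
have [z [w [zw xz az xw aw]]] := common_neighbours triP T_gt3 xa.
have NE : [set a; z; w] = nbrs x.
  apply/eqP; rewrite eqEcard !subUset !sub1set !inE xa xz xw /=.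
  by rewrite card_set3 ?(adj_neqP az) // eq_sym (adj_neqP aw).
rewrite -NE (mem_three_cycles triP) //; last exact: adj_sym.
have [u [v [uv xu zu xv zv]]] := common_neighbours triP T_gt3 xz.
have key q : x -- q -> z -- q -> q = a \/ q = w.
  move=> xq zq; have : q \in [set a; z; w] by rewrite NE inE.
  rewrite !inE => /orP[/orP[]|]/eqP qE; [by left| |by right].
  by have := adj_neqP zq; rewrite qE eqxx.
have [uE|<- //] := key u xu zu; have [vE|<- //] := key v xv zv.
by rewrite uE vE eqxx in uv.
Qed.

Lemma nbrs_separating x y : #|nbrs x| <= 3 -> y \notin nbrs x -> y != x -> sep (nbrs x).
Proof.
move=> le yN yx; rewrite /separating nbrs_three_cycle //.
apply/existsP; exists x; apply/existsP; exists y; rewrite nbrs_irr yN /=.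
by apply: contra yx => /linked_nbrs->.
Qed.

Lemma clique_link x (D : {set T}) : D \in three_cycles P -> inessential x ->
  {in D, forall a, x -- a} -> nbrs x = D.
Proof.
move=> D3 ix xD; have Dc : #|D| = 3 by move: D3; rewrite inE => /andP[/eqP].
apply: (link_closed triP) => //; first by rewrite -card_gt0 Dc.
move=> a aD; have /card_gt0P[b] : 0 < #|D :\ a|.
  by move: Dc; rewrite (cardsD1 a) aD add1n => -[->].
rewrite !inE => /andP[ba bD]; have ab : a != b by rewrite eq_sym.
have [c [ca cb DE]] := card3_third Dc aD bD ab.
have cD : c \in D by rewrite DE !inE eqxx !orbT.
have nosep y z : ~~ sep [set x; y; z].
  by apply/negP=> /ix; rewrite !inE eqxx.
exists b, c; split=> //; first by rewrite eq_sym.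
- exact: three_cycle_adj D3 aD bD ab.
- by apply: three_cycle_adj D3 aD cD _; rewrite eq_sym.
Qed.

Lemma leaf_adj D x u v : leaf D x -> link D x u -> u -- v -> link D x v \/ v \in D.
Proof.
case=> sD xD _ xu uv; have [vD|vD] := boolP (v \in D); first by right.
by left; apply: linked_adj xu uv vD.
Qed.

Lemma leaf_clique D x u : leaf D x -> link D x u -> {in D, forall a, u -- a} -> x = u.
Proof.
move=> lf xu uD; case: (lf) => sD xD ix.
have NE := clique_link (sep_cycle sD) (ix u xu) uD.
by apply: linked_nbrs; rewrite NE linked_sym.
Qed.

(* All edges at the inner side of the leaf are covered, and since y is a brace end
   outside of it, each of them meets the three other brace ends. *)
Lemma leaf_single D x y w : leaf D x -> y \notin D -> ~~ link D x y -> y ~~~ w ->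
  forall z, link D x z -> z = x.
Proof.
move=> lf yD xy yw z xz; case: (lf) => sD xD ix.
have [p [q [pq _ Bpq]]] := brace_cases yw.
pose W := [set w; p; q].
have ends u v : u ~~~ v -> u = y \/ u \in W.
  move=> /Bpq[]/set2_eq[]/and_comm[_ ->]; rewrite !inE ?eqxx ?orbT; auto.
have meet u v : link D x u -> u -- v -> u \in W \/ v \in W.
  move=> xu uv; have uN : u <> y by move=> uy; rewrite uy (negPf xy) in xu.
  have vN : v <> y.
    move=> vy; have [] := leaf_adj lf xu uv; rewrite vy; [exact: (negP xy)|exact: (negP yD)].
  have [|t [_ _]] := covered uv; first by move=> C /(ix u xu) uC; rewrite (negPf uC).
  by case=> /ends[] //; auto.
apply: contraTeq isT => zx.
(* A vertex of the side adjacent to all of [D] would have no other neighbours, hence be alone on the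
   side. *)
have notD u : link D x u -> exists2 a, a \in D & ~~ u -- a.
  move=> xu; apply/exists_inP; rewrite -negb_forall_in; apply/negP=> /forall_inP uD.
  have xE := leaf_clique lf xu uD.
  have NE : nbrs u = D by apply: clique_link (sep_cycle sD) (ix u xu) uD.
  case/eqP: zx; rewrite xE; apply: linked_nbrs; by rewrite NE -xE.
(* Three neighbours would form a separating triangle. No vertex of the side is in one, so this
   triangle would be [D], against [notD]. *)
have deg u : link D x u -> 3 < #|nbrs u|.
  move=> xu; rewrite ltnNge; apply/negP=> le.
  have sN : sep (nbrs u).
    apply: (nbrs_separating le (y := y)); last by apply: contraNneq xy => ->.
    rewrite inE; apply/negP=> uy; case: (leaf_adj lf xu uy); exact/negP.
  have ND : nbrs u \subset D.
    apply/subsetP=> v vN; have uv : u -- v by rewrite inE in vN.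
    by case: (leaf_adj lf xu uv) => // xv; have := ix v xv _ sN; rewrite vN.
  have NE : nbrs u = D by apply/eqP; rewrite eqEcard ND !sep_card.
  by have [a aD] := notD u xu; rewrite -NE inE in aD; rewrite aD.
have W3 : #|W| <= 3 by apply: card_set3_le.
(* All neighbours of a vertex outside [W] are in [W], which has too few elements for its degree. *)
have inW u : link D x u -> u \in W.
  move=> xu; apply: contraTT (deg u xu) => uW; rewrite -leqNgt.
  apply: leq_trans W3; apply/subset_leq_card/subsetP=> v; rewrite inE => uv.
  by case: (meet u v xu uv) => //; rewrite (negPf uW).
pose I := [set v | link D x v].
(* At most two of the at least four neighbours are in [D], so two are on the side, and these are in
   [W]. *)
have inner u : link D x u -> 1 < #|nbrs u :&: I|.
  move=> xu; have [a aD ua] := notD u xu.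
  have le2 : #|nbrs u :\: I| <= 2.
    have <- : #|D :\ a| = 2 by have := sep_card sD; rewrite (cardsD1 a) aD add1n => -[].
    apply/subset_leq_card/subsetP=> v; rewrite !inE => /andP[xv uv].
    have [xv'|->] := leaf_adj lf xu uv; first by rewrite xv' in xv.
    by rewrite andbT; apply: contraNneq ua => <-.
  have := deg u xu; rewrite -(cardsID I) ![_ < _]ltnNge; apply: contra => le1.
  exact: leq_add le1 le2.
(* If the brace end [u] is on the side, then of the elements of [W] only [w] can be its neighbour,
   against [inner]. With [p] and [q] both excluded, the side would be contained in the single vertex
   [w]. *)
have noadj u v : link D x u -> u ~~~ v -> [set w; u; v] = W -> False.
  move=> xu uv WE; have := inner u xu; apply/negP; rewrite -leqNgt -(cards1 w).
  apply/subset_leq_card/subsetP=> t; rewrite !inE => /andP[ut /inW].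
  rewrite -WE !inE => /orP[/orP[->//|]|]/eqP tE; subst t.
    by rewrite adj_irr in ut.
  by rewrite (brace_nadj uv) in ut.
have WC : [set w; q; p] = W by rewrite /W -!setUA [[set q] :|: _]setUC.
have [xp|xp] := boolP (link D x p); first by case: (noadj p q xp pq erefl).
have [xq|xq] := boolP (link D x q).
  by case: (noadj q p xq _ WC); rewrite adjC.
have := inner x (connect0 _ _); rewrite ltnNge -(cards1 w).
case/negP; apply/subset_leq_card/subsetP=> t; rewrite !inE => /andP[_ xt].
have := inW t xt; rewrite !inE => /orP[/orP[//|]|]/eqP tE; subst t.
  by rewrite xt in xp.
by rewrite xt in xq.
Qed.

(* By leaf_single, a leaf consists of one such vertex p, and the triangle is nbrs p. *)
Definition tip p := [/\ sep (nbrs p), inessential p, exists q, p ~~~ q &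
  forall c, p -- c -> exists y, p ~~~ y /\ adj G c y].

(** The covering brace is at [p]: a brace [cz] with [z] adjacent to [p] would join two vertices of
    the clique [nbrs p]. *)
Lemma tip_cover p : sep (nbrs p) -> inessential p ->
  forall c, p -- c -> exists y, p ~~~ y /\ adj G c y.
Proof.
move=> sN ip c pc; have [|z [pz cz]] := covered pc.
  by move=> D /ip pD; rewrite (negPf pD).
case=> [pz'|cz']; first by exists z.
move: pz; rewrite adj_braced => /orP[pz|pz]; last by exists z.
have := brace_nadj cz'; rewrite (sep_adj sN) ?inE //.
exact: brace_neq.
Qed.

(** The side opposite to an innermost side contains an innermost side as well, and thus the brace
    end that [leaf_single] needs. *)
Lemma tip_exists D x : sep D -> x \notin D -> exists2 p, tip p & link D x p.
Proof.
move=> sD xD; have [C [p [lf sub]]] := leaf_exists sD xD.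
case: (lf) => sC pC iC; have [y yC py] := sep_other sC pC.
have [C' [p' [lf' sub']]] := leaf_exists sC yC.
have [u [v [pu uv]]] := leaf_touched lf'.
have yu := sub' u pu; have uC := linked_notin yC yu.
have npu : ~~ link C p u.
  by apply: contra py => pu'; apply: linked_trans pu' _; rewrite linked_sym.
have single := leaf_single lf uC npu uv.
have NE : nbrs p = C.
  apply/setP=> c; rewrite inE; apply/idP/idP => [pc|cC].
    case: (leaf_adj lf (connect0 _ p) pc) => // /single cp.
    by rewrite cp adj_irr in pc.
  have [w pw cw] := sep_attach sC pC cC.
  by rewrite adjC -(single w pw).
have ip : inessential p by apply: iC; apply: connect0.
have sN : sep (nbrs p) by rewrite NE.
exists p; last by apply: sub; apply: connect0.
split=> //; last exact: tip_cover.
have [s [t [ps st]]] := leaf_touched lf.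
by exists t; rewrite -(single s ps).
Qed.

Lemma tip_nadj p p' : tip p -> tip p' -> p -- p' = false.
Proof.
by case=> sN _ _ _ [_ /(_ _ sN) ip' _ _]; move: ip'; rewrite inE => /negPf.
Qed.

(* A second vertex with the same neighbours leaves room for one brace only. *)
Lemma tip_twin p p' : tip p -> nbrs p' = nbrs p -> p' = p.
Proof.
case=> sN _ _ _ NE; apply: contraTeq isT => pp'.
have pN := nbrs_irr p; have pN' := nbrs_irr p'; rewrite NE in pN'.
have npp' : ~~ link (nbrs p) p p' by apply: contra pp' => /linked_nbrs->.
have all v : v \notin nbrs p -> v = p \/ v = p'.
  move=> vN; have [/linked_nbrs|pv] := boolP (link (nbrs p) p v); first by left.
  have := sep_two sN pN pN' vN npp' pv; rewrite -NE => /linked_nbrs; by right.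
have brE u v : u ~~~ v -> [set u; v] = [set p; p'].
  move=> uv; have uNv := brace_neq uv; have nuv := brace_nadj uv.
  have uN : u \notin nbrs p.
    apply/negP=> uN; have [vN|vN] := boolP (v \in nbrs p).
      by rewrite (sep_adj sN) in nuv.
    case: (all v vN) nuv => ->; rewrite adjC => nuv; last rewrite -NE in uN.
      by rewrite inE nuv in uN.
    by rewrite inE nuv in uN.
  have vN : v \notin nbrs p.
    apply/negP=> vN; case: (all u uN) nuv => -> nuv; last rewrite -NE in vN.
      by rewrite inE nuv in vN.
    by rewrite inE nuv in vN.
  move: uNv; case: (all u uN) => ->; case: (all v vN) => ->; rewrite ?eqxx //.
  by rewrite setUC.
have [u [v uv]] := brace_exists.
have [a [b [ab nE _]]] := brace_cases uv.
by rewrite (brE _ _ ab) (brE _ _ uv) eqxx in nE.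
Qed.

(** * The octahedron *)

(** Without separating triangles, a vertex with at most three neighbours is adjacent to all other
    vertices; these are pairwise adjacent, so no brace is possible. *)
Lemma all_nbrs_gt3 u : (forall D, ~~ sep D) -> 3 < #|nbrs u|.
Proof.
move=> nosep; rewrite ltnNge; apply/negP=> le.
have all y : y != u -> u -- y.
  move=> yu; have [|uy] := boolP (y \in nbrs u); first by rewrite inE.
  by have := nosep (nbrs u); rewrite (nbrs_separating le uy yu).
have [p [q pq]] := brace_exists; have npq := brace_nadj pq.
have pu : p != u.
  apply: contraFneq npq => pu; rewrite pu; apply: all.
  by rewrite -pu eq_sym brace_neq.
have qu : q != u by apply: contraFneq npq => ->; rewrite adjC all.
have pq' : p -- q.
  have [pN qN] : p \in nbrs u /\ q \in nbrs u by rewrite !inE !all.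
  exact: three_cycle_adj (nbrs_three_cycle le) pN qN (brace_neq pq).
by rewrite pq' in npq.
Qed.

Lemma octahedral (P_nosep : forall D, ~~ sep D) : braced_iso P B P_I B_I.
Proof.
have deg u := all_nbrs_gt3 u P_nosep.
have [x1 [y1 b1]] := brace_exists; have [x2 [y2 [b2 bN Bb]]] := brace_cases b1.
pose X := [set x1; y1] :|: [set x2; y2].
have ends u v : u ~~~ v -> u \in X.
  by case/Bb=> uv; rewrite inE -uv !inE eqxx ?orbT.
have meet u v : u -- v -> u \in X \/ v \in X.
  move=> uv; have [D sD|z [_ _]] := covered uv; first by have := P_nosep D; rewrite sD.
  by case=> /ends; [left|right].
have X4 : #|X| <= 4.
  by apply: leq_trans (leq_card_setU _ _) _; rewrite !cards2; case: (_ != _); case: (_ != _).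
(* All edges at [x] are covered, so its at least four neighbours are all brace ends. *)
have NX x : x \notin X -> nbrs x = X.
  move=> xX; apply/eqP; rewrite eqEcard (leq_trans X4) ?deg // andbT.
  by apply/subsetP=> v; rewrite inE => /meet[]//; rewrite (negPf xX).
have [x xX] : exists x, x \notin X.
  apply/existsP; apply: contraT => /existsPn XT.
  have := deg x1; rewrite -(leq_add2l 1) => le.
  have : #|x1 |: nbrs x1| <= #|X|.
    by apply/subset_leq_card/subsetP=> v _; apply/negPn/XT.
  by rewrite cardsU1 nbrs_irr => /leq_trans/(_ X4); rewrite leqNgt le.
have Nx := NX x xX.
have Xc : #|X| = 4 by apply/eqP; rewrite eqn_leq X4 -Nx deg.
have XE v : (v \in X) = [|| v == x1, v == y1, v == x2 | v == y2] by rewrite !inE -orbA.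
have uX : uniq [:: x1; y1; x2; y2].
  apply/card_uniqP; rewrite /= -Xc; apply: eq_card => v; rewrite XE !inE.
  by [].
have xadj v : v \in X -> x -- v by rewrite -Nx inE.
(* [x] and [a] have two common neighbours; these are in [X] and differ from [a] and from its partner
   [b]. *)
have cross a b c d : X = [set a; b] :|: [set c; d] -> a ~~~ b -> a -- c /\ a -- d.
  move=> XE' ab; have aX : a \in X by rewrite XE' !inE eqxx.
  have [z [w [zw xz az xw aw]]] := common_neighbours triP T_gt3 (xadj a aX).
  have key v : x -- v -> a -- v -> v = c \/ v = d.
    move=> xv av; have : v \in X by rewrite -Nx inE.
    rewrite XE' !inE => /orP[/orP[]|/orP[]]/eqP vE; [| |by left|by right].
      by rewrite vE adj_irr in av.
    by rewrite vE (brace_nadj ab) in av.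
  by move: zw (az) (aw); case: (key z xz az) => ->; case: (key w xw aw) => ->; rewrite ?eqxx.
have XE1 : X = [set y1; x1] :|: [set x2; y2] by rewrite [[set y1; x1]]setUC.
have XE2 : X = [set x2; y2] :|: [set x1; y1] by rewrite setUC.
have [x1x2 x1y2] := cross _ _ _ _ erefl b1.
have [y1x2 y1y2] : y1 -- x2 /\ y1 -- y2 by apply: (cross _ _ _ _ XE1); rewrite adjC.
(* The degree of [x1] yields a fourth neighbour besides [x], [x2] and [y2]; it is not [y1], the
   other end of the brace. *)
have [x' xx' x'X] : exists2 x', x' != x & x' \notin X.
  have : 0 < #|nbrs x1 :\: [set x; x2; y2]|.
    rewrite card_gt0 setD_eq0; apply/negP=> /subset_leq_card.
    by apply/negP; rewrite -ltnNge (leq_ltn_trans (card_set3_le _ _ _)).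
  case/card_gt0P=> x'; rewrite !inE !negb_or => /andP[/andP[/andP[x'x x'x2] x'y2] x1x'].
  exists x' => //; rewrite XE !negb_or x'x2 x'y2 !andbT.
  by rewrite eq_sym (adj_neqP x1x'); apply: contraTneq x1x' => ->; rewrite (brace_nadj b1).
have Nx' := NX x' x'X.
have xadj' v : v \in X -> x' -- v by rewrite -Nx' inE.
(* A third vertex off [X] would be a third common neighbour of [x1] and [x2], giving a separating
   triangle. *)
have all v : v \notin X -> v = x \/ v = x'.
  move=> vX; have Nv := NX v vX.
  have [->|vx] := eqVneq v x; first by left.
  have [->|vx'] := eqVneq v x'; first by right.
  have [||D _] := @common_neighbours_le2 _ _ _ triP x1 x2 x x' v x1x2.
  - move=> w; rewrite !inE => /or3P[]/eqP->; rewrite adjC [in X in _ && X]adjC.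
    + by rewrite !xadj // XE eqxx ?orbT.
    + by rewrite !xadj' // XE eqxx ?orbT.
    have : (x1 \in nbrs v) && (x2 \in nbrs v) by rewrite Nv !XE !eqxx !orbT.
    by rewrite !inE.
  - by rewrite /= !inE negb_or ![x == _]eq_sym xx' vx eq_sym vx'.
  by rewrite (negPf (P_nosep _)).
rewrite P_I_edges; pose s := [:: x1; x2; x; y1; y2; x'].
have inX : [&& x1 \in X, y1 \in X, x2 \in X & y2 \in X] by rewrite !XE !eqxx !orbT.
have /and4P[hx1 hy1 hx2 hy2] := inX.
have notX a b : a \in X -> b \notin X -> a != b by move=> aX; apply: contraNneq => <-.
apply: (@braced_iso_table T x1 5 s _ _ _ P B _ [:: (0, 3); (1, 4); (2, 5)]) => //.
- have E : perm_eq s [:: x; x'; x1; y1; x2; y2].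
    by rewrite /s; clear; apply/seq.permP=> a /=; lia.
  rewrite (perm_uniq E) cons_uniq cons_uniq uX andbT !inE eq_sym (negPf xx') /=.
  by move: xX x'X; rewrite !XE => -> ->.
- move=> v; rewrite !inE; have [|/all[]->] := boolP (v \in X); rewrite ?eqxx ?orbT //.
  by rewrite XE => /or4P[]->; rewrite ?orbT.
- have xr v : v \in X -> v -- x by rewrite adjC; apply: xadj.
  have xr' v : v \in X -> v -- x' by rewrite adjC; apply: xadj'.
  by rewrite /= !xr // !xr' // !xadj // x1x2 x1y2 y1y2 [x2 -- y1]adjC y1x2.
- rewrite /= (brace_nadj b1) (brace_nadj b2) andbT; have : x' \notin nbrs x by rewrite Nx.
  by rewrite inE.
apply/setP=> e; rewrite inE /= !inE; apply/idP/orP => [eB|].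
  case: brP => _ Bbr; have [e2 _] := Bbr e eB.
  have /cards2P[u [v [_ eE]]] : #|e| == 2 by apply/eqP.
  by rewrite eE; case: (Bb u v) => [|->|->]; [rewrite /adj -eE|left|right].
by case=> /eqP->; [exact: b1 | exact: b2].
Qed.

(** * Bipyramids at tips *)

Lemma set3_swap (x y z : T) : [set x; y; z] = [set y; x; z].
Proof. by rewrite [[set x; y]]setUC. Qed.

Lemma set3_rot (x y z : T) : [set x; y; z] = [set y; z; x].
Proof. by rewrite -setUA setUC. Qed.


Lemma inessential_sep x y z : inessential x -> ~~ sep [set x; y; z].
Proof. by move=> ix; apply/negP=> /ix; rewrite !inE eqxx. Qed.

(* With q, the vertices v and c3 fill the interior of the triangle q c1 c2. *)
Lemma pocket v q c1 c2 c3 : tip v -> q != v -> c1 != c2 -> nbrs v = [set c1; c2; c3] ->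
    q -- c1 -> q -- c2 -> q -- c3 ->
    ~~ sep [set q; c3; c1] -> ~~ sep [set q; c3; c2] ->
  nbrs c3 = [set v; c1; c2; q].
Proof.
move=> [sN iv _ _] qv c12 NE q1 q2 q3 n1 n2.
have vc c : c \in [set c1; c2; c3] -> v -- c by rewrite -NE inE.
have [v1 v2 v3] : [/\ v -- c1, v -- c2 & v -- c3] by split; apply: vc; rewrite !inE eqxx ?orbT.
have N3 : [set c1; c2; c3] \in three_cycles P by rewrite -NE sep_cycle.
have Nc : #|[set c1; c2; c3]| = 3 by rewrite -NE sep_card.
have [c31 c32] : c3 != c1 /\ c3 != c2.
  split; apply/eqP=> E; move: Nc; rewrite E.
    by rewrite setUC setUA setUid cards2; case: (_ != _).
  by rewrite -setUA setUid cards2; case: (_ != _).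
have c31P : c3 -- c1 by apply: (three_cycle_adj N3); rewrite // !inE eqxx ?orbT.
have c32P : c3 -- c2 by apply: (three_cycle_adj N3); rewrite // !inE eqxx ?orbT.
have q1N := adj_neqP q1; have q2N := adj_neqP q2.
(* Around [c3] these vertices form the 4-cycle [v c1 q c2]. Its edges form faces with [c3]: those at
   [v] because [v] is inessential, those at [q] by the last two hypotheses. *)
apply: (link_closed triP).
- by apply/set0Pn; exists v; rewrite !inE eqxx.
- move=> a; rewrite !inE -!orbA => /or4P[]/eqP->; rewrite ?c31P ?c32P //; exact: adj_sym.
have nv a b : ~~ sep [set a; v; b] by rewrite set3_swap inessential_sep.
have nv' a b : ~~ sep [set a; b; v] by rewrite set3_rot set3_rot inessential_sep.
have [mv m1 m2 mq] : [/\ v \in [set v; c1; c2; q], c1 \in [set v; c1; c2; q],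
    c2 \in [set v; c1; c2; q] & q \in [set v; c1; c2; q]].
  by rewrite !inE !eqxx !orbT.
have vq : v != q by rewrite eq_sym.
move=> a; rewrite !inE -!orbA => /or4P[]/eqP->.
- by exists c1, c2; split; [split | exact: c12 | exact: v1 | exact: v2 | split; exact: nv].
- exists v, q; split; [by split | exact: vq | exact: adj_sym v1 | exact: adj_sym q1 |].
  by split; [exact: nv' | rewrite set3_rot set3_rot; exact: n1].
- exists v, q; split; [by split | exact: vq | exact: adj_sym v2 | exact: adj_sym q2 |].
  by split; [exact: nv' | rewrite set3_rot set3_rot; exact: n2].
exists c1, c2; split; [by split | exact: c12 | exact: q1 | exact: q2 |].
by split; rewrite set3_swap.
Qed.

Lemma listed2 x0 (s : seq T) a b c d : (forall u w, u ~~~ w ->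
    [set u; w] = [set nth x0 s a; nth x0 s b] \/ [set u; w] = [set nth x0 s c; nth x0 s d]) ->
    nth x0 s a ~~~ nth x0 s b -> nth x0 s c ~~~ nth x0 s d ->
  B = listed x0 s [:: (a, b); (c, d)].
Proof.
move=> Bb ab cd; apply/setP=> e; rewrite inE /= !inE; apply/idP/orP => [eB|].
  case: brP => _ Bbr; have [e2 _] := Bbr e eB.
  have /cards2P[u [w [_ eE]]] : #|e| == 2 by apply/eqP.
  by rewrite eE; case: (Bb u w) => [|->|->]; [rewrite /adj -eE|left|right].
by case=> /eqP->; [exact: ab | exact: cd].
Qed.

Lemma card3_elements (C : {set T}) x : #|C| = 3 -> x \in C ->
  exists y z, [/\ y != x, z != x, z != y & C = [set x; y; z]].
Proof.
move=> C3 xC; have /card_gt0P[y] : 0 < #|C :\ x|.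
  by move: C3; rewrite (cardsD1 x) xC add1n => -[->].
rewrite !inE => /andP[yx yC]; have xy : x != y by rewrite eq_sym.
by have [z [zx zy CE]] := card3_third C3 xC yC xy; exists y, z.
Qed.


Lemma card3_neq (C : {set T}) x y z : #|C| = 3 -> C = [set x; y; z] ->
  [/\ x != y, x != z & y != z].
Proof.
move=> + CE; rewrite CE setUC cardsU1 cards2.
by rewrite !inE negb_or ![z == _]eq_sym; case: (x == y); case: (x == z); case: (y == z).
Qed.

Lemma pocket_inside (D : {set T}) v q c1 c2 c3 x : nbrs v = [set c1; c2; c3] ->
    nbrs c3 = [set v; c1; c2; q] -> D = [set q; c1; c2] -> v \notin D -> link D v x ->
  x = v \/ x = c3.
Proof.
move=> NE N3E -> vD vx.
apply: (linked_ind (Q := fun x => x = v \/ x = c3) vD vx); first by left.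
move=> a b ab _; rewrite !inE !negb_or => /andP[/andP[bNq b1] b2].
case=> aE.
  have : b \in nbrs v by rewrite inE -aE.
  by rewrite NE !inE (negPf b1) (negPf b2) => /eqP; right.
have : b \in nbrs c3 by rewrite inE -aE.
by rewrite N3E !inE (negPf b1) (negPf b2) (negPf bNq) !orbF => /eqP; left.
Qed.

(** Cases (II) and (III) differ in the braces only. The vertices a, t, c, m, h, k are [c3], [v],
    [c1], [q], [c2], [v']; the two sides of [nbrs v'] are [v'] alone and the pair [v], [c3]. *)
Lemma six_vertices v v' q c1 c2 c3 b : sep (nbrs v) -> sep (nbrs v') -> v -- v' = false ->
    v != v' -> nbrs v = [set c1; c2; c3] -> nbrs v' = [set q; c1; c2] ->
    nbrs c3 = [set v; c1; c2; q] -> all (fun p => (p.1 <= 5) && (p.2 <= 5)) b ->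
    B = listed v [:: c3; v; c1; q; c2; v'] b ->
  braced_iso P B P_II (edge_set 5 b).
Proof.
move=> sN sN' nvv' vv' NE N'E N3E b5 BE.
have v'N := nbrs_irr v'; have vN' : v \notin nbrs v' by rewrite inE adjC nvv'.
have [v'q v'c1 v'c2] : [/\ v' -- q, v' -- c1 & v' -- c2].
  have Q c : c \in nbrs v' -> v' -- c by rewrite inE.
  by split; apply: Q; rewrite N'E !inE eqxx ?orbT.
have [vc1 vc2 vc3] : [/\ v -- c1, v -- c2 & v -- c3].
  have Q c : c \in nbrs v -> v -- c by rewrite inE.
  by split; apply: Q; rewrite NE !inE eqxx ?orbT.
have [c3c1 c3c2 c3q] : [/\ c3 -- c1, c3 -- c2 & c3 -- q].
  have Q c : c \in nbrs c3 -> c3 -- c by rewrite inE.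
  by split; apply: Q; rewrite N3E !inE eqxx ?orbT.
have [qc1 qc2 c12] := card3_neq (sep_card sN') N'E.
have qc1P : q -- c1 by apply: (sep_adj sN'); rewrite ?inE.
have qc2P : q -- c2 by apply: (sep_adj sN'); rewrite ?inE.
have c12P : c2 -- c1 by apply: (sep_adj sN'); rewrite ?inE // eq_sym.
have vq : v != q by apply: contraFneq nvv' => ->; apply: adj_sym.
have nvq : v -- q = false.
  apply/negP=> vq'; have : q \in nbrs v by rewrite inE.
  rewrite NE !inE (negPf qc1) (negPf qc2) => /eqP qc3.
  by rewrite qc3 adj_irr in c3q.
have v'c3 : v' != c3 by apply: contraFneq nvv' => ->.
have nc3v' : c3 -- v' = false.
  apply/negP=> c3v'; have : v' \in nbrs c3 by rewrite inE.
  rewrite N3E !inE eq_sym (negPf vv') /=.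
  by rewrite (negPf (adj_neqP v'c1)) (negPf (adj_neqP v'c2)) (negPf (adj_neqP v'q)).
pose s := [:: c3; v; c1; q; c2; v'].
have all x : x \in s.
  have [xN|xN] := boolP (x \in nbrs v').
    by move: xN; rewrite N'E !inE => /orP[/orP[]|]->; rewrite ?orbT.
  have [/linked_nbrs->|v'x] := boolP (link (nbrs v') v' x); first by rewrite !inE eqxx !orbT.
  have v'v : ~~ link (nbrs v') v' v by apply: contra vv' => /linked_nbrs->.
  have := sep_two sN' v'N vN' xN v'v v'x.
  by case/(pocket_inside NE N3E N'E vN') => ->; rewrite !inE eqxx ?orbT.
have us : uniq s.
  have [[vc1' vc2'] vc3'] := (adj_neqP vc1, adj_neqP vc2, adj_neqP vc3).
  have [[v'c1' v'c2'] v'q'] := (adj_neqP v'c1, adj_neqP v'c2, adj_neqP v'q).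
  have [[c31 c32] c3q'] := (adj_neqP c3c1, adj_neqP c3c2, adj_neqP c3q).
  rewrite /= !inE !negb_or [c3 == v]eq_sym vc3' c31 c3q' c32 [c3 == v']eq_sym v'c3.
  rewrite vc1' vq vc2' vv' [c1 == q]eq_sym qc1 c12 [c1 == v']eq_sym v'c1' qc2.
  by rewrite [q == v']eq_sym v'q' [c2 == v']eq_sym v'c2'.
apply: (@braced_iso_table T v 5 s _ us all P B _ [:: (1, 3); (0, 5); (1, 5)]) => //.
- rewrite /= (adj_sym vc3) vc1 (adj_sym c3c1) c3q qc1P (adj_sym c3c2).
  by rewrite (adj_sym qc2P) c12P vc2 (adj_sym v'q) v'c2 v'c1.
by rewrite /= nvq nvv' nc3v'.
Qed.

(** * A brace joining two tips *)

(** Edges at [v'] can be covered by [vv'] only, so every neighbour of [v'] is [q] or a neighbour of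
    [v]. The tips are not twins, so [q] does occur, and [nbrs v'] arises from [nbrs v] by exchanging
    [c3] for [q]. *)
Lemma two_tips_common v v' q : tip v -> tip v' -> v != v' -> v ~~~ v' -> v ~~~ q -> q != v' ->
    (forall u w, u ~~~ w -> [set u; w] = [set v; v'] \/ [set u; w] = [set v; q]) ->
  braced_iso P B P_III B_III.
Proof.
move=> tv tv' vv' bv' bq qv' Bb; have [sN iv _ cv] := tv; have [sN' iv' _ cv'] := tv'.
have nvv' := brace_nadj bv'; have nvq := brace_nadj bq; have vq := brace_neq bq.
have ends u w : u ~~~ w -> u = v /\ (w = v' \/ w = q) \/ w = v /\ (u = v' \/ u = q).
  by case/Bb=> /set2_eq[[-> ->]|[-> ->]]; auto.
have twin : nbrs v' <> nbrs v by move/(tip_twin tv) => E; rewrite E eqxx in vv'.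
have N'sub c : v' -- c -> v -- c \/ c = q.
  move=> vc; have [y [vy cy]] := cv' c vc.
  have yv : y = v.
    case: (ends _ _ vy) => [[E _]|[//]]; by rewrite E eqxx in vv'.
  move: cy; rewrite yv adj_braced => /orP[cv1|/ends[[cE _]|[_ [cE|]]]]; [| | |by right].
  - by left; apply: adj_sym.
  - by rewrite cE adjC nvv' in vc.
  - by rewrite cE adj_irr in vc.
have v'q : v' -- q.
  apply/negPn/negP=> nq; apply: twin; apply/eqP; rewrite eqEcard !sep_card // andbT.
  apply/subsetP=> c; rewrite !inE => vc; case: (N'sub c vc) => // cq.
  by rewrite -cq vc in nq.
have [|c1 [c2 [c1q c2q c21 N'E]]] := card3_elements (sep_card sN') (x := q); first by rewrite inE.
have v'c1 : v' -- c1 by have : c1 \in nbrs v'; [rewrite N'E !inE eqxx orbT | rewrite inE].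
have v'c2 : v' -- c2 by have : c2 \in nbrs v'; [rewrite N'E !inE eqxx orbT | rewrite inE].
have vc1 : v -- c1 by case: (N'sub c1 v'c1) => // E; rewrite E eqxx in c1q.
have vc2 : v -- c2 by case: (N'sub c2 v'c2) => // E; rewrite E eqxx in c2q.
have c12 : c1 != c2 by rewrite eq_sym.
have [||c3 [c31 c32 NE]] := card3_third (sep_card sN) _ _ c12; rewrite ?inE //.
have vc3 : v -- c3 by have : c3 \in nbrs v; [rewrite NE !inE eqxx orbT | rewrite inE].
have c3q : c3 != q by apply: contraFneq nvq => <-.
have nv'c3 : v' -- c3 = false.
  apply/negP=> v'c3; have : c3 \in nbrs v' by rewrite inE.
  by rewrite N'E !inE (negPf c31) (negPf c32) (negPf c3q).
have c3v : c3 != v by rewrite eq_sym adj_neqP.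
have qc3 : q -- c3.
  have [y [vy c3y]] := cv c3 vc3.
  have [yv'|yq] : y = v' \/ y = q.
    by case: (ends _ _ vy) => [[_ //]|[yv]]; move: (brace_neq vy); rewrite yv eqxx.
  - move: c3y; rewrite yv' adj_braced adjC nv'c3 /= => /ends[[cE]|[E]].
      by rewrite cE eqxx in c3v.
    by rewrite E eqxx in vv'.
  - move: c3y; rewrite yq adj_braced adjC => /orP[//|/ends[[cE]|[E]]].
      by rewrite cE eqxx in c3v.
    by rewrite E eqxx in vq.
have qc1 : q -- c1 by apply: (sep_adj sN'); rewrite ?inE // eq_sym.
have qc2 : q -- c2 by apply: (sep_adj sN'); rewrite ?inE // eq_sym.
(* The common neighbour [c] links [v] and [v'] off the triangle. The other side would contain a tip,
   but the brace ends are only [v], [v'] and [q]. *)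
have nosep c c' : v -- c -> v' -- c -> c != c3 -> c != c' -> c != q -> ~~ sep [set q; c3; c'].
  move=> vc v'c cc3 cc' cq; apply/negP=> sD.
  have vD := iv _ sD; have v'D := iv' _ sD.
  have cD : c \notin [set q; c3; c'] by rewrite !inE !negb_or cc3 cc' cq.
  have [y yD vy] := sep_other sD vD.
  have [p [_ _ [t pt] _] yp] := tip_exists sD yD.
  have pD := linked_notin yD yp.
  have nvp : ~~ link [set q; c3; c'] v p.
    by apply: contra vy => vp; apply: linked_trans vp _; rewrite linked_sym.
  have vv'D : link [set q; c3; c'] v v'.
    have vcD := linked1 vc vD cD; apply: (linked_adj vD vcD) => //; exact: adj_sym.
  case: (ends _ _ pt) => [[pE _]|[_ [pE|pE]]].
  - by move: nvp; rewrite pE /linked connect0.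
  - by rewrite pE vv'D in nvp.
  - by rewrite pE !inE eqxx in pD.
have n1 : ~~ sep [set q; c3; c1] by apply: (nosep c2) => //; rewrite eq_sym.
have n2 : ~~ sep [set q; c3; c2] by apply: (nosep c1) => //; rewrite eq_sym.
have qv : q != v by rewrite eq_sym.
have N3E := pocket tv qv c12 NE qc1 qc2 qc3 n1 n2.
have v'N := nbrs_irr v'.
have vN' : v \notin nbrs v' by rewrite inE adjC nvv'.
have B3 : B = listed v [:: c3; v; c1; q; c2; v'] [:: (1, 3); (1, 5)].
  by apply: listed2 => // u w /Bb[]; [right | left].
exact: (six_vertices sN sN' nvv' vv' NE N'E N3E _ B3).
Qed.

(** If the second brace met neither tip, the edges at [v] would all be covered by [vv'], and the
    tips would be twins. *)
Lemma two_tips_braced v v' : tip v -> tip v' -> v != v' -> v ~~~ v' ->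
  braced_iso P B P_III B_III.
Proof.
move=> tv tv' vv' b; have [p [q [pq nE Bb]]] := brace_cases b.
have b' : v' ~~~ v by rewrite adjC.
have Bb' u w : u ~~~ w -> [set u; w] = [set v'; v] \/ [set u; w] = [set p; q].
  by move=> /Bb; rewrite [[set v'; v]]setUC.
have v'v : v' != v by rewrite eq_sym.
have [vpq|vpq] := boolP (v \in [set p; q]).
  have [t [tE tv'1]] : exists t, [set p; q] = [set v; t] /\ t != v'.
    case/set2P: vpq => vE; [exists q | exists p]; rewrite -vE ?[[set _; v]]setUC;
      by split=> //; apply: contraNneq nE => E; rewrite -vE E // setUC.
  rewrite tE in Bb; apply: (two_tips_common tv tv' vv' b _ tv'1 Bb).
  by rewrite /adj -tE.
have [vpq'|vpq'] := boolP (v' \in [set p; q]).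
  have [t [tE tv'1]] : exists t, [set p; q] = [set v'; t] /\ t != v.
    case/set2P: vpq' => vE; [exists q | exists p]; rewrite -vE ?[[set _; v']]setUC;
      by split=> //; apply: contraNneq nE => E; rewrite -vE E // setUC.
  rewrite tE in Bb'; apply: (two_tips_common tv' tv v'v b' _ tv'1 Bb').
  by rewrite /adj -tE.
have sub w w' : tip w -> w \notin [set p; q] -> w' \notin [set p; q] -> w != w' ->
    (forall s t, s ~~~ t -> [set s; t] = [set w; w'] \/ [set s; t] = [set p; q]) ->
    nbrs w \subset nbrs w'.
  move=> [_ _ _ cw] wpq wpq' ww' Bw; apply/subsetP=> c; rewrite !inE => wc.
  have [y [wy cy]] := cw c wc.
  have yE : y = w'.
    case: (Bw _ _ wy) => [/set2_eq[[_ //]|[E]]|E]; first by rewrite E eqxx in ww'.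
    by case/negP: wpq; rewrite -E !inE eqxx.
  move: cy; rewrite yE adj_braced adjC => /orP[//|/Bw[/set2_eq[[E]|[_ E]]|E]].
  - by rewrite E adj_irr in wc.
  - by rewrite E eqxx in ww'.
  by case/negP: wpq'; rewrite -E !inE eqxx orbT.
have s1 := sub v v' tv vpq vpq' vv' Bb.
have [sN _ _ _] := tv; have [sN' _ _ _] := tv'.
have E : nbrs v' = nbrs v by apply/esym/eqP; rewrite eqEcard s1 !sep_card.
by case/eqP: v'v; apply: tip_twin.
Qed.

(** * Two tips on different braces *)

(** The ends [q] and [q'] may coincide; this happens in case (IV). *)
Definition spread v q v' q' := [/\ tip v /\ tip v', v != v', v ~~~ q /\ v' ~~~ q',
  q != v' /\ q' != v &
  forall u w, u ~~~ w -> [set u; w] = [set v; q] \/ [set u; w] = [set v'; q']].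

Lemma spread_sym v q v' q' : spread v q v' q' -> spread v' q' v q.
Proof.
case=> [[? ?] ? [? ?] [? ?] Bb]; split=> //; first by rewrite eq_sym.
by move=> u w /Bb[]; [right|left].
Qed.

Lemma spread_exists v v' : tip v -> tip v' -> v != v' -> ~~ (v ~~~ v') ->
  exists q q', spread v q v' q'.
Proof.
move=> tv tv' vv' nb; have [_ _ [q bq] _] := tv; have [_ _ [q' bq'] _] := tv'.
have qv' : q != v' by apply: contraNneq nb => <-.
have qv : q' != v by apply: contraNneq nb => <-; rewrite adjC.
exists q, q'; split=> //; have [a [b [ab nE Bb]]] := brace_cases bq => u w /Bb[]; first by left.
move=> ->; right; case: (Bb _ _ bq') => // /set2_eq[[E _]|[E _]].
  by rewrite E eqxx in vv'.
by rewrite E eqxx in qv'.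
Qed.

Lemma spread_brace v q v' q' t : spread v q v' q' -> v ~~~ t -> t = q.
Proof.
case=> _ vv' [bq _] [_ q'v] Bb /Bb[]/set2_eq[[E tE]|[E tE]] //.
- by have := brace_neq bq; rewrite E eqxx.
- by rewrite E eqxx in vv'.
by rewrite E eqxx in q'v.
Qed.

Lemma spread_nbrs v q v' q' c : spread v q v' q' -> v -- c -> q -- c.
Proof.
move=> sp; have [[tv tv'] vv' [bq bq'] [qv' q'v] Bb] := sp => vc.
have [_ _ _ cv] := tv; have [y [vy cy]] := cv c vc.
move: cy; rewrite (spread_brace sp vy) adj_braced adjC => /orP[//|/Bb[]/set2_eq[[E E']|[E E']]].
- by rewrite E adj_irr in vc.
- by have := brace_nadj bq; rewrite -E vc.
- by rewrite E tip_nadj in vc.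
by rewrite E' eqxx in qv'.
Qed.

Lemma spread_no_twin v q v' q' : spread v q v' q' -> nbrs q <> nbrs v.
Proof.
by move=> [[tv _] _ [bq _] _ _] /(tip_twin tv) E; have := brace_neq bq; rewrite E eqxx.
Qed.

Lemma spread_other_end_not_tip v q v' q' : spread v q v' q' -> tip q -> False.
Proof.
move=> sp [sq _ _ _]; have [[[sN _ _ _] _] _ _ _ _] := sp.
apply: (spread_no_twin sp); apply/esym/eqP; rewrite eqEcard !sep_card // andbT.
by apply/subsetP=> c; rewrite !inE; apply: spread_nbrs sp.
Qed.

Lemma spread_tips v q v' q' p : spread v q v' q' -> tip p -> p = v \/ p = v'.
Proof.
move=> sp tp; have [_ _ [t pt] _] := tp; have [_ _ _ _ Bb] := sp.
case: (Bb _ _ pt) => /set2_eq[[->]|[pE]]; auto.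
  by case: (spread_other_end_not_tip sp); rewrite -pE.
by case: (spread_other_end_not_tip (spread_sym sp)); rewrite -pE.
Qed.

Lemma spread_sep v q v' q' D : spread v q v' q' -> sep D ->
  [/\ v \notin D, v' \notin D, ~~ link D v v' &
    forall x, x \notin D -> link D v x \/ link D v' x].
Proof.
move=> sp sD; have [[[_ iv _ _] [_ iv' _ _]] _ _ _ _] := sp.
have vD := iv D sD; have vD' := iv' D sD.
have all x : x \notin D -> link D v x \/ link D v' x.
  move=> xD; have [p tp xp] := tip_exists sD xD; rewrite !(linked_sym P D _ x).
  by case: (spread_tips sp tp) => <-; [left|right].
split=> //; have [y yD vy] := sep_other sD vD.
by case: (all y yD) => [vy'|vy']; [rewrite vy' in vy |
  apply: contra vy => vv'; apply: linked_trans vv' vy'].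
Qed.

(** On its side of [q a b], the tip [v'] reaches a neighbour of [a] without meeting [c], which is
    next to [v]. Continued through [a] to [v], this path avoids [q c b], so the latter does not
    separate the tips. *)
Lemma spread_nosep v q v' q' a b c : spread v q v' q' -> uniq [:: a; b; c] ->
  nbrs v = [set a; b; c] -> sep [set q; a; b] -> ~~ sep [set q; c; b].
Proof.
move=> sp; rewrite /= !inE !negb_or andbT => /andP[/andP[ab ac] bc] NE sD; apply/negP=> sD'.
have [vD v'D nvv' _] := spread_sep sp sD.
have [vD' v'D' nvv'' _] := spread_sep sp sD'.
have [_ _ [bq _] _ _] := sp.
have vN d : d \in nbrs v -> v -- d by rewrite inE.
have va : v -- a by apply: vN; rewrite NE !inE eqxx.
have vc : v -- c by apply: vN; rewrite NE !inE eqxx orbT.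
have cq : c != q by apply: contraFneq (brace_nadj bq) => <-.
have aq : a != q by apply: contraFneq (brace_nadj bq) => <-.
have cD : c \notin [set q; a; b] by rewrite !inE !negb_or cq ![c == _]eq_sym ac bc.
have aD' : a \notin [set q; c; b] by rewrite !inE !negb_or aq ac ab.
have [|w v'w aw] := sep_attach sD v'D (a := a); first by rewrite !inE eqxx orbT.
have v'w' : link [set q; c; b] v' w.
  apply: (linked_transfer v'D v'w) => u v'u; have := linked_notin v'D v'u.
  rewrite !inE !negb_or => /andP[/andP[-> ua] ->]; rewrite andbT /=.
  apply: contraNneq nvv' => uE; rewrite linked_sym; rewrite uE in v'u.
  by apply: (linked_adj v'D v'u) => //; apply: adj_sym.
case/negP: nvv''; rewrite linked_sym.
have v'a := linked_adj v'D' v'w' (adj_sym aw) aD'.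
by apply: (linked_adj v'D' v'a) => //; apply: adj_sym.
Qed.

(** If no triangle [q a b] with [a], [b] in [nbrs v] separated, [link_closed] would make [q] a twin
    of [v]. For the last clause, a separating triangle through [c3] avoids [v]; with [q] it would be
    one of those excluded by [spread_nosep]. *)
Lemma spread_pocket v q v' q' : spread v q v' q' -> exists c1 c2 c3,
  [/\ uniq [:: c1; c2; c3], nbrs v = [set c1; c2; c3], sep [set q; c1; c2],
      nbrs c3 = [set v; c1; c2; q] & forall D, sep D -> c3 \in D -> D = nbrs v].
Proof.
move=> sp; have [[tv tv'] vv' [bq bq'] [qv' q'v] Bb] := sp.
have [sN iv _ _] := tv; have N3 := sep_card sN.
have qN c : c \in nbrs v -> q -- c by rewrite inE; apply: spread_nbrs sp.
have [/exists_inP[c1 c1N /exists_inP[c2 c2N /andP[c12 sD]]]|/exists_inPn no] :=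
    boolP [exists a in nbrs v, exists b in nbrs v, (a != b) && sep [set q; a; b]]; last first.
  case: (spread_no_twin sp); apply: (link_closed triP) => //.
    by rewrite -card_gt0 N3.
  move=> a aN; have [b [c [ba ca cb NE]]] := card3_elements N3 aN.
  have bN : b \in nbrs v by rewrite NE !inE eqxx orbT.
  have cN : c \in nbrs v by rewrite NE !inE eqxx orbT.
  have ab : a != b by rewrite eq_sym.
  have ac : a != c by rewrite eq_sym.
  have bc : b != c by rewrite eq_sym.
  exists b, c; split=> //; try exact: (sep_adj sN).
  have := no a aN; move=> /exists_inPn no'.
  by have := no' b bN; have := no' c cN; rewrite ab ac.
have [c3 [c31 c32 NE]] := card3_third N3 c1N c2N c12.
have c3N : c3 \in nbrs v by rewrite NE !inE eqxx orbT.
have uc : uniq [:: c1; c2; c3] by rewrite /= !inE negb_or c12 eq_sym c31 eq_sym c32.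
have n2 : ~~ sep [set q; c3; c2] by apply: (spread_nosep sp uc NE sD).
have n1 : ~~ sep [set q; c3; c1].
  apply: (spread_nosep sp (a := c2)); last by rewrite set3_rot set3_swap set3_rot set3_rot.
    by rewrite /= !inE negb_or eq_sym c12 eq_sym c32 eq_sym c31.
  by rewrite NE set3_swap.
have qv : q != v by rewrite eq_sym brace_neq.
have N3E := pocket tv qv c12 NE (qN _ c1N) (qN _ c2N) (qN _ c3N) n1 n2.
exists c1, c2, c3; split=> // D sE c3E.
have vD := iv D sE.
have inA x : x \in D -> x != c3 -> [|| x == c1, x == c2 | x == q].
  move=> xD xc3; have : x \in nbrs c3 by rewrite inE (sep_adj sE) // eq_sym.
  have xv : x != v by apply: contraNneq vD => <-.
  by rewrite N3E !inE (negPf xv) /= orbA.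
have [x [y [xc yc yx DE]]] := card3_elements (sep_card sE) c3E.
have xD : x \in D by rewrite DE !inE eqxx orbT.
have yD : y \in D by rewrite DE !inE eqxx orbT.
have n2' : ~~ sep [set c3; q; c2] by rewrite set3_swap.
have n1' : ~~ sep [set c3; q; c1] by rewrite set3_swap.
have n2'' : ~~ sep [set c3; c2; q] by rewrite set3_rot set3_rot.
have n1'' : ~~ sep [set c3; c1; q] by rewrite set3_rot set3_rot.
move: yx sE; rewrite DE NE.
case/or3P: (inA x xD xc) => /eqP->; case/or3P: (inA y yD yc) => /eqP->; rewrite ?eqxx //.
- by move=> _ _; rewrite set3_rot.
- by rewrite (negPf n1'').
- by move=> _ _; rewrite set3_rot set3_swap.
- by rewrite (negPf n2'').
- by rewrite (negPf n1').
by rewrite (negPf n2').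
Qed.

(* By spread_pocket, the brace vq comes with a bipyramid over c1 c2 c3 with apexes v
   and q; v and c3 are alone on their side of the triangle q c1 c2. *)
Definition pocketed v q c1 c2 c3 :=
  [/\ uniq [:: c1; c2; c3], nbrs v = [set c1; c2; c3], sep [set q; c1; c2],
      nbrs c3 = [set v; c1; c2; q] & forall D, sep D -> c3 \in D -> D = nbrs v].

Lemma spread_c3 v q v' q' c1 c2 c3 : spread v q v' q' -> pocketed v q c1 c2 c3 ->
  [/\ v -- c1, v -- c2, v -- c3, c3 \notin [set q; c1; c2] & c3 != q].
Proof.
move=> sp [uc NE sD _ _]; have [_ _ [bq _] _ _] := sp.
have vN d : d \in [set c1; c2; c3] -> v -- d by rewrite -NE inE.
have vc3 : v -- c3 by apply: vN; rewrite !inE eqxx orbT.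
have c3q : c3 != q by apply: contraFneq (brace_nadj bq) => <-.
split=> //; try by apply: vN; rewrite !inE eqxx ?orbT.
move: uc; rewrite /= !inE !negb_or c3q andbT => /andP[/andP[_ c13] c23].
by rewrite ![c3 == _]eq_sym c13.
Qed.

Lemma sep_eq C D : sep C -> sep D -> C \subset D -> C = D.
Proof. by move=> sC sD CD; apply/eqP; rewrite eqEcard CD !sep_card. Qed.

Lemma sep_diff C D : sep C -> sep D -> C <> D -> exists2 c, c \in C & c \notin D.
Proof. by move=> sC sD CD; apply/subsetPn/negP=> /(sep_eq sC sD). Qed.

(* Among the separating triangles whose v'-side lies properly inside that of
   q c1 c2, take one, E, with the largest v'-side. An edge dy with d in E off
   q c1 c2 and y on the v-side of E is in no separating triangle. It is thus
   covered by a brace, and this leaves only d = c3' and E = N(v'), for which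
   q' c1' c2' has a larger v'-side. *)
Lemma spread_chain v q v' q' c1 c2 c3 c1' c2' c3' z0 : spread v q v' q' ->
    pocketed v q c1 c2 c3 -> pocketed v' q' c1' c2' c3' ->
    link [set q; c1; c2] v' z0 -> z0 != v' ->
  [set q; c1; c2] = [set q'; c1'; c2'].
Proof.
move=> sp po po'; set D := [set q; c1; c2]; set D' := [set q'; c1'; c2'] => v'z0 z0v'.
have sp' := spread_sym sp.
have [[tv tv'] vv' [bq bq'] [qv' q'v] Bb] := sp.
have [uc NE sD N3E c3D] := po; have [uc' NE' sD' N3E' c3D'] := po'.
have [vc1 vc2 vc3 c3nD c3q] := spread_c3 sp po.
have [vc1' vc2' vc3' c3nD' c3q'] := spread_c3 sp' po'.
have [vD v'D nvv' allD] := spread_sep sp sD.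
have [vD' v'D' _ _] := spread_sep sp sD'.
have [sN iv _ _] := tv; have [sN' iv' _ _] := tv'.
have inside x : link D v x -> x = v \/ x = c3 by apply: pocket_inside NE N3E erefl vD.
apply/eqP; apply: contraT => /eqP DD'.
pose K E := [set x | link E v' x].
pose F E := sep E && (K E \proper K D).
(* The vertex [z0] ensures that there is a candidate at all. *)
have FN' : F (nbrs v').
  rewrite /F sN' /=; apply/properP; split.
    by apply/subsetP=> x; rewrite !inE => /linked_nbrs->; apply: connect0.
  by exists z0; rewrite inE //; apply: contra z0v' => /linked_nbrs->.
pose E := [arg max_(E > nbrs v' | F E) #|K E|].
have [FE maxE] : F E /\ forall C, F C -> #|K C| <= #|K E|.
  by rewrite /E; case: arg_maxnP => // A FA mA; split=> // C /mA.
have /andP[sE /properP[KED _]] := FE.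
have ED : E <> D by move=> ED; move: FE; rewrite /F ED properxx andbF.
have [vE v'E nvE allE] := spread_sep sp sE.
(* Otherwise [E] is [nbrs v], whose [v']-side contains [q]; but [q] is in [D] and cannot be on the
   [v']-side of [D]. *)
have c3E : c3 \notin E.
  apply/negP=> /(c3D _ sE) EN.
  have qE : q \notin E by rewrite EN inE brace_nadj.
  have v'q : link E v' q.
    case: (allE q qE) => //; rewrite EN => /linked_nbrs qv.
    by have := brace_neq bq; rewrite qv eqxx.
  have /(subsetP KED) : q \in K E by rewrite inE.
  by rewrite inE => /(linked_notin v'D); rewrite !inE eqxx.
have v'in u : u \in E -> u \notin D -> link D v' u.
  move=> uE uD; case: (allD u uD) => // /inside[] uE'; subst u.
    by rewrite uE in vE.
  by rewrite uE in c3E.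
have [d dE dD] := sep_diff sE sD ED.
have v'd := v'in d dE dD.
have ndv : v -- d = false.
  apply/negP=> vd; have : d \in nbrs v by rewrite inE.
  rewrite NE !inE => /orP[/orP[]|]/eqP dc.
  - by rewrite dc !inE eqxx orbT in dD.
  - by rewrite dc !inE eqxx !orbT in dD.
  by rewrite -dc dE in c3E.
have [y vy dy] := sep_attach sE vE dE.
have yE := linked_notin vE vy.
have nv'y : ~~ link E v' y.
  by apply: contra nvE => v'y; apply: linked_trans vy _; rewrite linked_sym.
(* The [v']-side of such a [C] would contain that of [E] and a vertex of [E] off [C], but not [d],
   and would stay inside that of [D], against the choice of [E]. *)
have nsep C : sep C -> d \in C -> y \in C -> False.
  move=> sC dC yC; have [vC v'C nvC _] := spread_sep sp sC.
  have yu u : u \in C -> u != y -> y -- u.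
    by move=> uC uy; apply: (sep_adj sC); rewrite // eq_sym.
  have KEC : {subset K E <= K C}.
    move=> x; rewrite !inE => v'x; apply: (linked_transfer v'E v'x) => u v'u.
    apply/negP=> uC; case/negP: nv'y; have [<- //|uy] := eqVneq u y.
    by apply: (linked_adj v'E v'u) => //; apply/adj_sym/yu.
  have EC : E <> C by move=> EC; rewrite EC yC in yE.
  have [e eE eC] := sep_diff sE sC EC.
  have [w v'w ew] := sep_attach sE v'E eE.
  have v'w' : link C v' w by have : w \in K C; [apply: KEC; rewrite inE | rewrite inE].
  have v'e := linked_adj v'C v'w' (adj_sym ew) eC.
  have : #|K E| < #|K C|.
    apply/proper_card/properP; split; first exact/subsetP.
    by exists e; rewrite inE //; apply/negP=> /(linked_notin v'E); rewrite eE.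
  rewrite ltnNge maxE // /F sC /=; apply/properP; split; last first.
    by exists d; rewrite inE //; apply/negP=> /(linked_notin v'C); rewrite dC.
  apply/subsetP=> x; rewrite !inE => v'x; apply: (linked_transfer v'C v'x) => u v'u.
  apply/negP=> uD; have [w' vw' uw'] := sep_attach sD vD uD.
  have uC := linked_notin v'C v'u.
  have vwC : link C v w'.
    case: (inside w' vw') => ->; first exact: connect0.
    apply: linked1 => //; apply/negP=> /(c3D _ sC) CN.
    by have := ndv; rewrite CN inE in dC; rewrite dC.
  case/negP: nvC; apply: (linked_trans (y := u)); last by rewrite linked_sym.
  exact: (linked_adj vC vwC (adj_sym uw') uC).
(* Since [d] is not adjacent to [v] nor [y] to [v'], the only brace that can cover [dy] is [v'q'],
   with [y] as [q']. *)
have [yq' dv'] : y = q' /\ v' -- d.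
  have [C sC dC yC|z [dz yz]] := covered dy; first exact: nsep sC dC yC.
  have v'notE w : w \in E -> w != v' by move=> wE; apply: contraNneq v'E => <-.
  have dNv : d != v by apply: contraNneq vE => <-.
  have dNq : d != q by apply: contraNneq dD => ->; rewrite !inE eqxx.
  have dNv' := v'notE d dE.
  have yNv' : y != v' by apply: contraNneq nv'y => ->; apply: connect0.
  have nyv' : y -- v' = false.
    by apply/negP=> yv'; case/negP: nv'y; apply: linked1 => //; apply: adj_sym.
  have ends a b : a ~~~ b -> [\/ a = v /\ b = q, a = q /\ b = v, a = v' /\ b = q' |
      a = q' /\ b = v'].
    by move=> /Bb[]/set2_eq[]; [constructor 1|constructor 2|constructor 3|constructor 4].
  have yNd : y != d by rewrite eq_sym adj_neqP.
  case=> [/ends[][aE zE]|/ends[][aE zE]].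
  - by rewrite aE eqxx in dNv.
  - by rewrite aE eqxx in dNq.
  - by rewrite aE eqxx in dNv'.
  - move: yz; rewrite zE adj_braced nyv' => /ends[][yE' E2].
    + by rewrite -E2 eqxx in qv'.
    + by rewrite E2 eqxx in vv'.
    + by rewrite yE' eqxx in yNv'.
    + by rewrite yE' -aE eqxx in yNd.
  - by have := dy; rewrite aE adjC ndv.
  - move: dz; rewrite zE adj_braced adjC ndv => /ends[][dE' E2].
    + by rewrite dE' eqxx in dNv.
    + by rewrite dE' eqxx in dNq.
    + by rewrite dE' eqxx in dNv'.
    + by rewrite E2 eqxx in vv'.
  - by rewrite aE eqxx in yNv'.
  split=> //; move: dz; rewrite zE adj_braced adjC => /orP[//|/ends[][dE' E2]].
  - by rewrite dE' eqxx in dNv.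
  - by rewrite dE' eqxx in dNq.
  - by rewrite dE' eqxx in dNv'.
  - by rewrite aE dE' eqxx in yNd.
have dc3' : d = c3'.
  have : d \in nbrs v' by rewrite inE.
  rewrite NE' !inE => /orP[/orP[]|]/eqP // dc; case: (nsep D' sD').
  - by rewrite dc !inE eqxx orbT.
  - by rewrite yq' !inE eqxx.
  - by rewrite dc !inE eqxx !orbT.
  by rewrite yq' !inE eqxx.
have EN : E = nbrs v' by apply: c3D'; rewrite -?dc3'.
have inside' x : link D' v' x -> x = v' \/ x = c3'.
  exact: pocket_inside NE' N3E' erefl v'D'.
have KE1 : #|K E| <= 1.
  rewrite -(cards1 v'); apply/subset_leq_card/subsetP=> x; rewrite !inE EN.
  by move=> /linked_nbrs->.
have v'c3' : v' != c3' by apply: adj_neqP.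
have KD' : [set v'; c3'] \subset K D'.
  by rewrite subUset !sub1set !inE /linked connect0 connect1 // /adj_off vc3' v'D'.
have : 1 < #|K D'|.
  by apply: leq_trans (subset_leq_card KD'); rewrite cards2 v'c3'.
rewrite ltnNge (leq_trans _ KE1) // maxE // /F sD' /= properE; apply/andP; split.
  by apply/subsetP=> x; rewrite !inE => /inside'[]->; [exact: connect0 | rewrite -dc3'].
(* If the [v']-sides of [D] and [D'] agreed, each vertex of [D] would be adjacent to [v'] or [c3'],
   hence belong to [D']. *)
apply/negP=> KDD'; apply: DD'; apply: sep_eq => //; apply/subsetP=> u uD.
have [w v'w uw] := sep_attach sD v'D uD.
have : w \in K D' by apply: (subsetP KDD'); rewrite inE.
have uv' : u != v' by apply: contraNneq v'D => <-.
have uc3' : u != c3' by apply: contraNneq dD; rewrite dc3' => <-.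
rewrite inE => /inside'[] wE.
  have : u \in nbrs v' by rewrite inE -wE adjC.
  by rewrite NE' !inE (negPf uc3') orbF => /orP[]->; rewrite ?orbT.
have : u \in nbrs c3' by rewrite inE -wE adjC.
by rewrite N3E' !inE (negPf uv') /= => /orP[/orP[]|]->; rewrite ?orbT.
Qed.

(** * Recognition of (II), (IV) and (V) *)

(** As [v'] is alone on its side, its neighbours are [q], [c1], [c2]; the end [q'] is none of them,
    which leaves only [c3]. *)
Lemma spread_II v q v' q' c1 c2 c3 : spread v q v' q' -> pocketed v q c1 c2 c3 ->
    (forall x, link [set q; c1; c2] v' x -> x = v') -> braced_iso P B P_II B_II.
Proof.
move=> sp po only; have [[tv tv'] vv' [bq bq'] [qv' q'v] Bb] := sp.
have [uc NE sD N3E _] := po; have [sN _ _ _] := tv; have [sN' _ _ _] := tv'.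
have [vD v'D _ allD] := spread_sep sp sD.
have nvv' := tip_nadj tv tv'.
have N'E : nbrs v' = [set q; c1; c2].
  apply: sep_eq => //; apply/subsetP=> x; rewrite inE => v'x.
  apply/negPn/negP=> xD; have := only x (linked1 v'x v'D xD).
  by move=> xv'; rewrite xv' adj_irr in v'x.
have q'c3 : q' = c3.
  have q'D : q' \notin [set q; c1; c2] by rewrite -N'E inE brace_nadj.
  case: (allD q' q'D) => [/(pocket_inside NE N3E erefl vD)[//|//]|/only] E.
    by rewrite E eqxx in q'v.
  by have := brace_neq bq'; rewrite E eqxx.
apply: (six_vertices sN sN' nvv' vv' NE N'E N3E) => //.
apply: listed2 => //=; last by rewrite -q'c3.
by move=> u w /Bb; rewrite q'c3.
Qed.

Lemma pocketed_swap v q c1 c2 c3 : pocketed v q c1 c2 c3 -> pocketed v q c2 c1 c3.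
Proof.
case=> uc NE sD N3E c3D; split=> //.
- move: uc; rewrite /= !inE !negb_or !andbT => /andP[/andP[c12 ->] ->].
  by rewrite eq_sym c12.
- by rewrite NE set3_swap.
- by rewrite set3_swap set3_rot.
by rewrite N3E; congr (_ :|: _); rewrite set3_rot set3_swap set3_rot set3_rot.
Qed.

(** The sides of the common triangle are the pairs [v], [c3] and [v'], [c3'], and no edge joins
    different sides. *)
Lemma seven_vertices v q v' q' c1 c2 c3 c1' c2' c3' : spread v q v' q' ->
    pocketed v q c1 c2 c3 -> pocketed v' q' c1' c2' c3' ->
    [set q; c1; c2] = [set q'; c1'; c2'] ->
  [/\ uniq [:: v; c3; q; c1; c2; v'; c3'], forall x, x \in [:: v; c3; q; c1; c2; v'; c3'],
      v -- c3' = false, c3 -- v' = false & c3 -- c3' = false].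
Proof.
move=> sp po po' DE; have sp' := spread_sym sp.
have [[tv tv'] vv' [bq bq'] [qv' q'v] Bb] := sp.
have [uc NE sD N3E _] := po; have [uc' NE' sD' N3E' _] := po'.
have [vc1 vc2 vc3 c3D c3q] := spread_c3 sp po.
have [vc1' vc2' vc3' c3D' c3q'] := spread_c3 sp' po'.
have [vD v'D _ allD] := spread_sep sp sD.
have nvv' := tip_nadj tv tv'.
have v'c3 : v' != c3 by apply: contraFneq nvv' => ->.
have vc3N : v != c3' by apply: contraFneq nvv' => ->; apply: adj_sym.
have nD x : x \notin [set q; c1; c2] -> [/\ x != q, x != c1 & x != c2].
  by rewrite !inE !negb_or => /andP[/andP[]].
move: (c3D'); rewrite -DE => c3'D.
have [vq vc1N vc2N] := nD v vD; have [v'q v'c1 v'c2] := nD v' v'D.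
have [hq h1 h2] := nD c3 c3D; have [hq' h1' h2'] := nD c3' c3'D.
have nvc : v -- c3' = false.
  apply/negP=> vc; have : v \in nbrs c3' by rewrite inE adjC.
  rewrite N3E' => vI; have : v \in [set q'; c1'; c2'].
    by move: vI; rewrite !inE (negPf vv') /= orbC orbA.
  by rewrite -DE (negPf vD).
have c33 : c3 != c3' by apply: contraFneq nvc => <-.
have nc3v' : c3 -- v' = false.
  apply/negP=> vc; have : v' \in nbrs c3 by rewrite inE.
  by rewrite N3E !inE eq_sym (negPf vv') (negPf v'q) (negPf v'c1) (negPf v'c2).
have ncc : c3 -- c3' = false.
  apply/negP=> vc; have : c3' \in nbrs c3 by rewrite inE.
  by rewrite N3E !inE eq_sym (negPf vc3N) (negPf hq') (negPf h1') (negPf h2').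
have [qc1 qc2 c12] := card3_neq (sep_card sD) erefl.
split=> //.
  rewrite /= !inE !negb_or (adj_neqP vc3) vq vc1N vc2N vv' vc3N hq h1 h2 c33.
  rewrite [c3 == v']eq_sym v'c3 qc1 qc2 c12 (adj_neqP vc3').
  by rewrite ![_ == v']eq_sym v'q v'c1 v'c2 ![_ == c3']eq_sym hq' h1' h2'.
move=> x; have [xD|xD] := boolP (x \in [set q; c1; c2]).
  by move: xD; rewrite !inE => /orP[/orP[]|]->; rewrite ?orbT.
case: (allD x xD) => [/(pocket_inside NE N3E erefl vD)|/(pocket_inside NE' N3E' DE v'D)][]->;
  by rewrite !inE eqxx ?orbT.
Qed.

Lemma pocketed_adj v q v' q' c1 c2 c3 : spread v q v' q' -> pocketed v q c1 c2 c3 ->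
  [/\ [/\ v -- c1, v -- c2 & v -- c3], [/\ c3 -- c1, c3 -- c2 & c3 -- q] &
      [/\ q -- c1, q -- c2 & c1 -- c2]].
Proof.
move=> sp po; have [vc1 vc2 vc3 _ _] := spread_c3 sp po.
have [uc NE sD N3E _] := po; have [qc1 qc2 c12] := card3_neq (sep_card sD) erefl.
have Q c : c \in [set v; c1; c2; q] -> c3 -- c by rewrite -N3E inE.
split; [by split | by split; apply: Q; rewrite !inE eqxx ?orbT |].
by split; apply: (sep_adj sD) => //; rewrite !inE eqxx ?orbT.
Qed.

Lemma spread_IV v q v' c1 c2 c3 c3' : spread v q v' q ->
    pocketed v q c1 c2 c3 -> pocketed v' q c1 c2 c3' -> braced_iso P B P_IV B_IV.
Proof.
move=> sp po po'; have [us all n1 n2 n3] := seven_vertices sp po po' erefl.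
have [[tv tv'] _ [bq bq'] _ Bb] := sp; have nvv' := tip_nadj tv tv'.
have [[v1 v2 v3] [d1 d2 dq] [q1 q2 c12]] := pocketed_adj sp po.
have [[v1' v2' v3'] [d1' d2' dq'] _] := pocketed_adj (spread_sym sp) po'.
(* In the order s1, s2, s3, s4, v1, v2, v3. *)
pose s := [:: c1; c3; c2; c3'; q; v; v'].
have E : perm_eq s [:: v; c3; q; c1; c2; v'; c3'].
  by rewrite /s; clear; apply/seq.permP=> a /=; lia.
have us' : uniq s by rewrite (perm_uniq E).
have all' x : x \in s by rewrite (perm_mem E).
apply: (@braced_iso_table T v 6 s _ us' all' P B _
          [:: (1, 3); (1, 6); (5, 3); (5, 6); (4, 5); (4, 6)]) => //.
- rewrite /= c12 (adj_sym v2) v1 dq' (adj_sym dq) (adj_sym v3) d1' q1 d1 d2 q2 d2'.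
  by rewrite (adj_sym v3') v1' v2'.
- by rewrite /= n1 n2 n3 nvv' ![q -- _]adjC !brace_nadj.
apply: (listed2 (s := s)); rewrite /= 1?adjC // => u w.
by rewrite ![[set q; _]]setUC; apply: Bb.
Qed.

Lemma spread_V v q v' c1 c2 c3 c3' : spread v q v' c1 ->
    pocketed v q c1 c2 c3 -> pocketed v' c1 q c2 c3' -> braced_iso P B P_V B_V.
Proof.
move=> sp po po'; have [us all n1 n2 n3] := seven_vertices sp po po' (set3_swap _ _ _).
have [[tv tv'] _ [bq bq'] _ Bb] := sp; have nvv' := tip_nadj tv tv'.
have [[v1 v2 v3] [d1 d2 dq] [q1 q2 c12]] := pocketed_adj sp po.
have [[v1' v2' v3'] [d1' d2' dq'] _] := pocketed_adj (spread_sym sp) po'.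
(* The same order; s4 is now the tip [v'], and its brace ends at s3, which is [c1]. *)
pose s := [:: c2; c3; c1; v'; q; v; c3'].
have E : perm_eq s [:: v; c3; q; c1; c2; v'; c3'].
  by rewrite /s; clear; apply/seq.permP=> a /=; lia.
have us' : uniq s by rewrite (perm_uniq E).
have all' x : x \in s by rewrite (perm_mem E).
apply: (@braced_iso_table T v 6 s _ us' all' P B _
          [:: (1, 3); (1, 6); (5, 3); (5, 6); (4, 5); (3, 2)]) => //.
- rewrite /= (adj_sym c12) (adj_sym v1) v2 v1' (adj_sym dq) (adj_sym v3) v2' q2 d2 d1 q1.
  by rewrite v3' d2' dq' (adj_sym d1').
- by rewrite /= n1 n2 n3 nvv' [q -- _]adjC !brace_nadj.
apply: (listed2 (s := s)) => //=; last by rewrite adjC.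
by move=> u w; rewrite [[set q; _]]setUC; apply: Bb.
Qed.

Lemma set3_eq_cases (x y z a b : T) : #|[set x; y; z]| = 3 -> [set x; y; z] = [set x; a; b] ->
  a = y /\ b = z \/ a = z /\ b = y.
Proof.
move=> C3 E; have [xy xz yz] := card3_neq C3 erefl; have [xa xb ab] := card3_neq C3 E.
have: a \in [set x; y; z] by rewrite E !inE eqxx orbT.
have: b \in [set x; y; z] by rewrite E !inE eqxx orbT.
rewrite !inE ![_ == x]eq_sym (negPf xa) (negPf xb) /=.
by case/orP=> /eqP bE /orP[]/eqP aE; subst; rewrite ?eqxx in ab; auto.
Qed.

(** Unless [v'] is alone on its side, both bipyramids fill sides of one triangle. The place of [q']
    in it decides: [q' = q] gives (IV), the other two vertices give (V). *)
Lemma spread_iso v q v' q' : spread v q v' q' ->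
  [\/ braced_iso P B P_II B_II, braced_iso P B P_IV B_IV | braced_iso P B P_V B_V].
Proof.
move=> sp; have [c1 [c2 [c3 po]]] := spread_pocket sp.
have [c1' [c2' [c3' po']]] := spread_pocket (spread_sym sp).
have [/existsP[z /andP[v'z zv']]|/existsPn only] :=
    boolP [exists z, link [set q; c1; c2] v' z && (z != v')]; last first.
  constructor 1; apply: (spread_II sp po) => x v'x.
  by have := only x; rewrite v'x negbK => /eqP.
have DE := spread_chain sp po po' v'z zv'.
have C3 : #|[set q; c1; c2]| = 3 by case: po => _ _ /sep_card.
have C3s : #|[set q; c2; c1]| = 3 by case: (pocketed_swap po) => _ _ /sep_card.
have : q' \in [set q; c1; c2] by rewrite DE !inE eqxx.
rewrite !inE => /orP[/orP[]|]/eqP qE; subst q'.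
- constructor 2; case: (set3_eq_cases C3 DE) po' => -[-> ->] po'; first exact: spread_IV sp po po'.
  exact: spread_IV sp po (pocketed_swap po').
- constructor 3; move: C3 DE; rewrite set3_swap => C3 /(set3_eq_cases C3)[][E1 E2]; subst.
    exact: spread_V sp po po'.
  exact: spread_V sp po (pocketed_swap po').
constructor 3; move: C3s DE; rewrite set3_swap => C3' DE.
have {}DE : [set c2; q; c1] = [set c2; c1'; c2'] by rewrite -DE set3_rot set3_rot.
case: (set3_eq_cases C3' DE) => -[E1 E2]; subst.
  exact: spread_V sp (pocketed_swap po) po'.
exact: spread_V sp (pocketed_swap po) (pocketed_swap po').
Qed.

Lemma irreducible_iso :
  braced_iso P B P_I B_I \/ braced_iso P B P_II B_II \/
  braced_iso P B P_III B_III \/ braced_iso P B P_IV B_IV \/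
  braced_iso P B P_V B_V.
Proof.
have [/existsP[D sD]|/existsPn nosep] := boolP [exists D, sep D]; last first.
  by left; apply: octahedral.
have [_ /existsP[x /existsP[y /and3P[xD yD xy]]]] := andP sD.
have [v tv xv] := tip_exists sD xD; have [v' tv' yv'] := tip_exists sD yD.
have vv' : v != v'.
  apply: contraNneq xy => vE; rewrite vE in xv.
  by apply: linked_trans xv _; rewrite linked_sym.
have [b|nb] := boolP (v ~~~ v'); first by right; right; left; apply: two_tips_braced tv tv' vv' b.
have [q [q' sp]] := spread_exists tv tv' vv' nb.
by case: (spread_iso sp); auto.
Qed.

End Braced.

Theorem theorem4p1 (T : finType) (P : {set {set T}}) (r : T -> {perm T})
    (B : {set {set T}}) :
  braced_triangulation P r B -> irreducible P B -> #|B| = 2 ->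
  braced_iso P B P_I B_I \/ braced_iso P B P_II B_II \/
  braced_iso P B P_III B_III \/ braced_iso P B P_IV B_IV \/
  braced_iso P B P_V B_V.
Proof.
move=> brP irr B2; exact: (irreducible_iso brP irr B2).
Qed.
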